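(* Let $(\mathcal S,\mathcal A,H,P,R,\mu)$ be an episodic tabular MDP as described in the context, with non-negative rewards of expectations $r$. 1. (Worst-case distributions.) $$CR^H(P,r)=\max_{\pi\in\Pi^{\mathcal M}}\frac{\sum_{(h,s,a)\in\mathcal X}d_h^{\pi}(s,a)\,r_h(s,a)}{\sum_{(h,s,a)\in\mathcal X}d_h^*(s)\,r_h(s,a)}.$$ 2. (Worst-case reward expectations.) $$CR^H(P)=\max_{\pi\in\Pi^{\mathcal M}}\min_{(h,s,a)\in\mathcal X}\frac{d_h^{\pi}(s,a)}{d_h^*(s)}.$$ If instead the infimum defining $CR^H(P)$ is taken only over stationary expectations $r_h(s,a)=r(s,a)$ with $r\in[0,1]^{SA}$, then $$CR^H(P)=\max_{\pi\in\Pi^{\mathcal M}}\min_{(s,a)\in\mathcal S\times\mathcal A}\frac{\sum_{h=1}^H d_h^{\pi}(s,a)}{\sum_{h=1}^H d_h^*(s)}.$$ 3. (Worst-case environments.) For every environment (any $P$, $\mu$ and non-negative reward distribution), $CR^H(P,r)\ge\max\{\frac{1}{SAH},\frac{1}{A^H}\}$. Conversely, for every $\delta\in(0,1)$ there exist stationary environments with rewards supported in $[0,1]$ such that: if $S=A^n+1$ for some $n\in\{0,\dots,H-1\}$ then $CR^H(P,r)\le\frac{1+\delta}{(H-\log_A(S-1))(A-1)(S-1)}$; and if $S\ge A^H-1$ then $CR^H(P,r)\le\frac{1+\delta}{A^H}$.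
   Context: Episodic tabular MDP $(\mathcal S,\mathcal A,H,P,R,\mu)$: finite state space $\mathcal S$ with $|\mathcal S|=S$, finite action space $\mathcal A$ with $|\mathcal A|=A$, horizon $H\in\mathbb N$, transition kernels $P_h(\cdot\mid s,a)$, initial state distribution $\mu$, and random non-negative rewards $R_h(s,a)$ for $(h,s,a)\in\mathcal X:=[H]\times\mathcal S\times\mathcal A$. Initially $s_1\sim\mu$; at step $h$ the agent in state $s_h$ picks $a_h$, receives $R_h(s_h,a_h)$ and moves to $s_{h+1}\sim P_h(\cdot\mid s_h,a_h)$. All rewards are drawn before the interaction. The vectors $\mathcal R_h=\{R_h(s,a)\}_{s,a}$ for different $h$ are mutually independent (entries of one $\mathcal R_h$ may be arbitrarily correlated); rewards are independent of transitions, and transitions are independent across steps. Let $r_h(s,a)=\mathbb E[R_h(s,a)]$ and let $\mathcal D(r)$ denote the set of all such reward distributions with means $r$. For $L\in\{0,\dots,H\}$ an $L$-lookahead policy draws $a_h\sim\pi_h(\cdot\mid s_h,\mathcal R_h^L)$, where $\mathcal R_h^L=(\mathcal R_t)_{h\le t\le\min(h+L-1,H)}$ and $\mathcal R_h^0=\emptyset$; $\Pi^L$ is the set of these policies and $\Pi^{\mathcal M}=\Pi^0$ is the set of (possibly randomized) Markovian policies. The value is $V^{L,\pi}(P,r)=\mathbb E[\sum_{h=1}^H R_h(s_h,a_h)]$, and $V^{L,*}(P,r)=\sup_{\pi\in\Pi^L}V^{L,\pi}(P,r)$; $V^{0,*}$ depends only on $P,\mu,r$. The competitive ratio is $CR^L(P,r)=\inf_{\mathcal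 D(r)}V^{0,*}(P,r)/V^{L,*}(P,r)$, with the convention that any division by zero equals $+\infty$. Also $CR^L(P)=\inf\{CR^L(P,r): r_h\in[0,1]^{SA}\ \forall h\}$. Occupancy measures: $d_h^\pi(s)=\Pr(s_h=s)$ and $d_h^\pi(s,a)=\Pr(s_h=s,a_h=a)$ under $\pi$. For $t\le h$, $d_h^\pi(s\mid s_t=s')$ is the probability of being at $s$ at step $h$ when at $s'$ at step $t$ and following $\pi$. $d_h^*(s)=\max_{\pi\in\Pi^{\mathcal M}}d_h^\pi(s)$ and $d_h^*(s\mid s_t=s')=\max_{\pi\in\Pi^{\mathcal M}}d_h^\pi(s\mid s_t=s')$. An environment is stationary if $P_h$ and the distribution of $\mathcal R_h$ do not depend on $h$. *)

(* Defs.v *)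
From HB Require Import structures.
From mathcomp Require Import all_boot all_order all_algebra.
From mathcomp Require Import all_classical all_reals all_analysis.
Set Implicit Arguments. Unset Strict Implicit. Unset Printing Implicit Defensive.
Import Order.TTheory GRing.Theory Num.Theory.
Local Open Scope classical_set_scope.
Local Open Scope ring_scope.

(* Conventions: steps are 0-indexed, h = 0, ..., H-1 (paper's step h+1).
   Objects indexed by steps are functions on nat; only h < H matters. *)

Section MDP.
Variables (R : realType) (S A : finType).

Definition is_dist (T : finType) (p : T -> R) :=
  (forall t, 0 <= p t) /\ \sum_(t : T) p t = 1.

Definition is_kernel (H : nat) (P : nat -> S -> A -> S -> R) :=
  forall h, (h < H)%N -> forall s a, is_dist (P h s a).

Definition markov_policy (H : nat) (pi : nat -> S -> A -> R) :=
  forall h, (h < H)%N -> forall s, is_dist (pi h s).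

(* State occupancy d_h(s) = Pr(s_h = s) of the Markov chain started from mu,
   playing decision rules pi_h and moving with P_h. *)
Fixpoint occS (P : nat -> S -> A -> S -> R) (mu : S -> R)
    (pi : nat -> S -> A -> R) (h : nat) : S -> R :=
  match h with
  | 0 => mu
  | h'.+1 => fun s' => \sum_(s : S) \sum_(a : A)
                occS P mu pi h' s * pi h' s a * P h' s a s'
  end.

Definition occSA P mu pi h s a := occS P mu pi h s * pi h s a.

Definition occ_star (H : nat) P mu h s :=
  sup [set occS P mu pi h s | pi in markov_policy H].

Definition rew := nat -> S -> A -> R.

(* L-lookahead policy: pi h s w is the distribution of a_h given s_h = s and
   the reward realization w, required to depend on w only through the window
   R_h^L = (R_t)_{h <= t <= min(h+L-1, H-1)} (0-indexed). *)
Definition lookahead_policy (H L : nat) (pi : nat -> S -> rew -> A -> R) :=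
  (forall h s w, (h < H)%N -> is_dist (pi h s w)) /\
  (forall h s (w w' : rew), (h < H)%N ->
     (forall t, (h <= t < minn (h + L) H)%N -> w t = w' t) ->
     pi h s w = pi h s w').

Definition orthants : set (set (S -> A -> R)) :=
  [set [set v | forall s a, v s a <= c s a] | c in [set: S -> A -> R]].
Definition borelSA : set (set (S -> A -> R)) := <<s orthants >>.

(* Reward distribution in D(r): random rewards X h s a : Omega -> R on a
   probability space, non-negative, measurable, with means r, and reward
   vectors (X h)_h mutually independent across steps h < H (entries of one
   vector may be arbitrarily correlated). *)
Definition rvec d (Omega : measurableType d) (X : nat -> S -> A -> Omega -> R)
  (h : nat) (om : Omega) : S -> A -> R := fun s a => X h s a om.

Definition reward_dist (H : nat) (r : rew) d (Omega : measurableType d)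
    (Pr : probability Omega R) (X : nat -> S -> A -> Omega -> R) :=
  [/\ (forall h s a, (h < H)%N -> measurable_fun setT (X h s a)),
      (forall h s a om, (h < H)%N -> 0 <= X h s a om),
      (forall h s a, (h < H)%N -> (\int[Pr]_om (X h s a om)%:E = (r h s a)%:E)%E)
    & (forall B : nat -> set (S -> A -> R), (forall h, (h < H)%N -> borelSA (B h)) ->
        fine (Pr [set om | forall h, (h < H)%N -> B h (rvec X h om)])
        = \prod_(h < H) fine (Pr [set om | B h (rvec X h om)]))].

(* Value of an L-lookahead policy: E[ sum_h R_h(s_h,a_h) ].  Given the reward
   realization w, the state-action process is the Markov chain with decision
   rules pi_h(. | ., w) (transitions are independent of rewards). *)
Definition value (H : nat) P mu d (Omega : measurableType d)
    (Pr : probability Omega R) (X : nat -> S -> A -> Omega -> R)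
    (pi : nat -> S -> rew -> A -> R) : \bar R :=
  (\int[Pr]_om
     (\sum_(h < H) \sum_(s : S) \sum_(a : A)
        occSA P mu (fun t s' => pi t s' (fun t'' => rvec X t'' om)) h s a
        * X h s a om)%:E)%E.

Definition Vstar (H L : nat) P mu d (Omega : measurableType d)
    (Pr : probability Omega R) X : \bar R :=
  ereal_sup [set value H P mu Pr X pi | pi in lookahead_policy H L].

Definition ediv (x y : \bar R) : \bar R :=
  if y == 0%E then +oo%E else (fine x / fine y)%:E.

Definition CR (H L : nat) P mu (r : rew) : \bar R :=
  ereal_inf [set x | exists d (Omega : measurableType d)
      (Pr : probability Omega R) (X : nat -> S -> A -> Omega -> R),
      reward_dist H r Pr X /\
      x = ediv (Vstar H 0 P mu Pr X) (Vstar H L P mu Pr X)].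

Definition CR_P (H L : nat) P mu : \bar R :=
  ereal_inf [set CR H L P mu r | r in
     [set r : rew | forall h s a, (h < H)%N -> 0 <= r h s a <= 1]].

Definition CR_P_stat (H L : nat) P mu : \bar R :=
  ereal_inf [set CR H L P mu (fun _ => r) | r in
     [set r : S -> A -> R | forall s a, 0 <= r s a <= 1]].

Definition is_max (T : Type) (D : set T) (f : T -> \bar R) (v : \bar R) :=
  (exists2 x, D x & f x = v) /\ (forall x, D x -> (f x <= v)%E).

Definition min_hsa (H : nat) (f : nat -> S -> A -> \bar R) : \bar R :=
  \big[Order.min/+oo%E]_(h < H) \big[Order.min/+oo%E]_(s : S)
     \big[Order.min/+oo%E]_(a : A) f h s a.

Definition min_sa (f : S -> A -> \bar R) : \bar R :=
  \big[Order.min/+oo%E]_(s : S) \big[Order.min/+oo%E]_(a : A) f s a.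

Definition stationary (H : nat) (P : nat -> S -> A -> S -> R) d (Omega : measurableType d)
    (Pr : probability Omega R) (X : nat -> S -> A -> Omega -> R) :=
  (forall h h', (h < H)%N -> (h' < H)%N -> P h = P h') /\
  (forall h h' B, (h < H)%N -> (h' < H)%N -> borelSA B ->
     Pr [set om | B (rvec X h om)] = Pr [set om | B (rvec X h' om)]).

End MDP.

(* Main.v *)
Require Import Defs.
From HB Require Import structures.
From mathcomp Require Import all_boot all_order all_algebra.
From mathcomp Require Import all_classical all_reals all_analysis.
From mathcomp Require Import measurable_realfun ring lra zify.
Set Implicit Arguments.
Unset Strict Implicit.
Unset Printing Implicit Defensive.
Import Order.TTheory GRing.Theory Num.Theory.
Import numFieldNormedType.Exports.
Local Open Scope classical_set_scope.
Local Open Scope ring_scope.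

(* A Markovian policy cannot use the realised rewards, while a policy with full
   lookahead earns, realisation by realisation, at most [occ_star] times the
   reward. This benchmark is approached by "long shots", independent rewards worth
   [r / eps] with probability [eps]: almost always at most one prize is announced,
   and the agent heads for it along a policy maximising the probability of
   reaching it. So the competitive ratio is the best Markovian return divided by
   the benchmark.

   In terms of occupancy measures, which form a compact convex polytope, both are
   linear in the means. The infimum over the means then becomes a minimum over
   single entries by a minimax argument: minimising the squared violation of the
   constraints [d >= v d_star] produces a worst mean when they are infeasible.

   The lower bounds come from the policy aiming at the best entry and from the
   uniform policy; the matching instances are trees in which each trajectory meets
   one reward only, whereas each leaf is reachable with certainty. *)

(** * A duality statement over compact convex sets *)

Lemma continuous_sum (R : realType) (T : topologicalType) (I : Type)
    (s : seq I) (F : I -> T -> R) :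
  (forall i, continuous (F i)) -> continuous (fun x => \sum_(i <- s) F i x).
Proof. by move=> cF; apply: continuous_big => //; exact: add_continuous. Qed.

(* [v] minimises the squared violation [\sum_j max(0, c j - g j v)^2]; the vector
   of violations at [v] is then a weight [rho] that the hypothesis contradicts
   unless it vanishes. *)
Lemma compact_convex_dominating (R : realType) (V : normedModType R)
    (J : finType) (D : set V) (g : J -> V -> R) (c : J -> R) :
  D !=set0 -> compact D -> (forall j, continuous (g j)) ->
  (forall u v t, D u -> D v -> 0 <= t <= 1 -> D (u + t *: (v - u))) ->
  (forall j u v t, g j (u + t *: (v - u)) = g j u + t * (g j v - g j u)) ->
  (forall rho : J -> R, (forall j, 0 <= rho j) ->
     exists2 v, D v & \sum_j rho j * c j <= \sum_j rho j * g j v) ->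
  exists2 v, D v & forall j, c j <= g j v.
Proof.
move=> D0 cD cg convD affg hyp.
pose q v := \sum_j (Num.max 0 (c j - g j v)) ^+ 2.
have cq : continuous q.
  apply: continuous_sum => j.
  have cj : continuous (fun x : V => Num.max 0 (c j - g j x)).
    apply: (@max_fun_continuous _ V R (cst 0)); first exact: cst_continuous.
    by move=> w; apply: cvgB; [exact: cvg_cst|exact: cg].
  by move=> v; apply: cvgM; exact: cj.
have [d0 /set_mem Dd0 mind0] :
    exists2 d, d \in D & forall t, t \in D -> q d <= q t.
  by apply: compact_EVT_min => //; exact: continuous_subspaceT.
pose rho j := Num.max 0 (c j - g j d0).
have rho0 j : 0 <= rho j by rewrite le_max lexx.
have [d Dd hd] := hyp rho rho0.
exists d0 => //.
pose w j := g j d - g j d0.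
pose B := \sum_j rho j * w j; pose W := \sum_j w j ^+ 2.
have W0 : 0 <= W by apply: sumr_ge0 => j _; exact: sqr_ge0.
(* First-order condition at the minimiser along the segment towards [d]: each violation at parameter
   [t] is either zero or at most [rho j - t * w j], so [q] lies below an explicit quadratic in
   [t]. *)
have step t : 0 <= t <= 1 -> 2 * t * B <= t ^+ 2 * W.
  move=> t01; have Dt := convD _ _ t Dd0 Dd t01.
  have := mind0 _ (mem_set Dt).
  have : q (d0 + t *: (d - d0)) <= q d0 - 2 * t * B + t ^+ 2 * W.
    rewrite /B /W /q !mulr_sumr -sumrB -big_split /=; apply: ler_sum => j _.
    rewrite affg -/(w j) -/(rho j).
    have -> : rho j ^+ 2 - 2 * t * (rho j * w j) + t ^+ 2 * w j ^+ 2
              = (rho j - t * w j) ^+ 2 by ring.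
    have h1 : c j - g j d0 <= rho j by rewrite le_max lexx orbT.
    case: (leP 0 (c j - (g j d0 + t * w j))) => h.
      rewrite ler_sqr ?nnegrE; lra.
    by rewrite expr0n /= sqr_ge0.
  move=> h1 h2; lra.
have B0 : B <= 0.
  rewrite leNgt; apply/negP => B0.
  (* For this step [t * W < B], so the linear gain [2 * t * B] would exceed the quadratic term. *)
  pose t := Num.min 1 (B / (W + 1)).
  have t0 : 0 < t by rewrite lt_min ltr01 divr_gt0 //; lra.
  have t1 : t <= 1 by rewrite ge_min lexx.
  have tB : t * (W + 1) <= B by rewrite -ler_pdivlMr ?ge_min ?lexx ?orbT //; lra.
  have := step t; rewrite t1 ltW // => /(_ isT).
  nra.
have : \sum_j rho j ^+ 2 <= 0.
  (* Since [rho j] vanishes unless the constraint is violated,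
     [rho j ^+ 2 = rho j * (c j - g j d0)]. Passing from [d0] to [d] adds [B], and the rest is
     nonpositive by the choice of [d]. *)
  have -> : \sum_j rho j ^+ 2
      = \sum_j rho j * c j - \sum_j rho j * g j d + B.
    rewrite /B -sumrB -big_split /=; apply: eq_bigr => j _.
    rewrite /w /rho; case: (leP 0 (c j - g j d0)) => _; ring.
  lra.
move=> sum0 j.
have : rho j ^+ 2 <= 0.
  apply: le_trans sum0; rewrite (bigD1 j) //= lerDl.
  by apply: sumr_ge0 => i _; exact: sqr_ge0.
rewrite -subr_le0; have : c j - g j d0 <= rho j by rewrite le_max lexx orbT.
have := rho0 j; nra.
Qed.

(** * Finite distributions and the polytope of occupancy measures *)

Lemma is_dist_indicator (R : realType) (T : finType) (x : T) :
  is_dist (fun t => (t == x)%:R : R).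
Proof.
split=> [t|]; first by rewrite ler0n.
by rewrite (bigD1 x) //= eqxx big1 ?addr0 // => t /negPf ->.
Qed.

Lemma is_dist_le1 (R : realType) (T : finType) (p : T -> R) t : is_dist p -> p t <= 1.
Proof.
by move=> [p0 <-]; rewrite (bigD1 t) //= lerDl; apply: sumr_ge0.
Qed.

Section Occupancy.
Variables (R : realType) (S A : finType) (H : nat).
Variables (P : nat -> S -> A -> S -> R) (mu : S -> R).
Hypotheses (kP : is_kernel H P) (dmu : is_dist mu).

Definition return_of (pi : nat -> S -> A -> R) (r : rew R S A) : R :=
  \sum_(h < H) \sum_s \sum_a occSA P mu pi h s a * r h s a.

Lemma eq_occS (pi pi' : nat -> S -> A -> R) h :
  (forall t, (t < h)%N -> pi t = pi' t) -> occS P mu pi h = occS P mu pi' h.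
Proof.
elim: h => [//|h IH] epi /=.
rewrite (IH (fun t th => epi t (ltnW th))) (epi h (ltnSn h)).
by apply: funext.
Qed.

Lemma occS_ge0 pi h s : markov_policy H pi -> (h <= H)%N -> 0 <= occS P mu pi h s.
Proof.
move=> mpi; elim: h s => [|h IH] s hH /=; first by case: dmu.
apply: sumr_ge0 => s' _; apply: sumr_ge0 => a _.
rewrite !mulr_ge0 ?IH 1?ltnW //; first by case: (mpi _ hH s').
by case: (kP hH s' a).
Qed.

Lemma sum_occSA pi h s : markov_policy H pi -> (h < H)%N ->
  \sum_a occSA P mu pi h s a = occS P mu pi h s.
Proof. by move=> mpi hH; rewrite -mulr_sumr; case: (mpi _ hH s) => _ ->; rewrite mulr1. Qed.

Lemma sum_occS pi h : markov_policy H pi -> (h <= H)%N ->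
  \sum_s occS P mu pi h s = 1.
Proof.
move=> mpi; elim: h => [|h IH] hH /=; first by case: dmu.
rewrite exchange_big /= -[RHS](IH (ltnW hH)); apply: eq_bigr => s _.
rewrite -[in RHS](sum_occSA _ mpi hH) exchange_big; apply: eq_bigr => a _ /=.
by rewrite -mulr_sumr; case: (kP hH s a) => _ ->; rewrite mulr1.
Qed.

Lemma occS_le1 pi h s : markov_policy H pi -> (h <= H)%N -> occS P mu pi h s <= 1.
Proof.
move=> mpi hH; rewrite -(sum_occS mpi hH) (bigD1 s) //= lerDl.
by apply: sumr_ge0 => i _; exact: occS_ge0.
Qed.

Lemma occSA_ge0 pi h s a : markov_policy H pi -> (h < H)%N -> 0 <= occSA P mu pi h s a.
Proof.
by move=> mpi hH; rewrite mulr_ge0 ?occS_ge0 1?ltnW //; case: (mpi _ hH s).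
Qed.

Lemma occSA_le pi h s a : markov_policy H pi -> (h < H)%N ->
  occSA P mu pi h s a <= occS P mu pi h s.
Proof.
by move=> mpi hH; rewrite ler_piMr ?occS_ge0 1?ltnW // is_dist_le1 //; exact: mpi.
Qed.

Definition uniform_policy : nat -> S -> A -> R := fun _ _ _ => #|A|%:R^-1.

(* The occupancy measures form a polytope, cut out by the flow equations: unlike
   the return as a function of the policy, everything is linear on it. *)
Definition flow (d : nat -> S -> A -> R) :=
  [/\ forall h s a, (h < H)%N -> 0 <= d h s a,
      (0 < H)%N -> forall s, \sum_a d 0%N s a = mu s &
      forall h s, (h.+1 < H)%N ->
        \sum_a d h.+1 s a = \sum_s' \sum_a d h s' a * P h s' a s].

Lemma flow_occSA pi : markov_policy H pi -> flow (occSA P mu pi).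
Proof.
move=> mpi; split=> [h s a hH|H0 s|h s hH]; first exact: occSA_ge0.
  by rewrite (sum_occSA _ mpi).
by rewrite (sum_occSA _ mpi).
Qed.

Hypothesis HA : (0 < #|A|)%N.

Lemma uniform_policyP : markov_policy H uniform_policy.
Proof.
move=> h _ s; split=> [a|]; first by rewrite invr_ge0.
by rewrite sumr_const -[_ *+ _]mulr_natl mulfV // pnatr_eq0 -lt0n.
Qed.

(** The policy is the conditional law of the action given the state. Where a state carries no mass
    the quotient is meaningless and the uniform law replaces it; [d] vanishes there anyway. *)
Lemma flow_policy d : flow d -> exists2 pi, markov_policy H pi &
  forall h s a, (h < H)%N -> occSA P mu pi h s a = d h s a.
Proof.
move=> [d0 dmu' dP].
pose m h s := \sum_a d h s a.
pose pi h s a := if m h s == 0 then uniform_policy h s a else d h s a / m h s.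
have m0 h s : (h < H)%N -> 0 <= m h s by move=> hH; apply: sumr_ge0 => a _; exact: d0.
have dm h s a : (h < H)%N -> m h s = 0 -> d h s a = 0.
  move=> hH /eqP; rewrite psumr_eq0; last by move=> i _; exact: d0.
  by move=> /allP/(_ a (mem_index_enum _))/eqP.
have mpi : markov_policy H pi.
  move=> h hH s; rewrite /pi; case: eqP => [_|/eqP m_neq0].
    exact: (uniform_policyP hH).
  split=> [a|]; first by rewrite divr_ge0 ?d0 ?m0.
  by rewrite -mulr_suml mulfV.
have piE h s a : (h < H)%N -> m h s * pi h s a = d h s a.
  move=> hH; rewrite /pi; case: eqP => [e|/eqP m_neq0]; first by rewrite e mul0r dm.
  by rewrite mulrC divfK.
exists pi => //.
suff occE h s : (h < H)%N -> occS P mu pi h s = m h s.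
  by move=> h s a hH; rewrite /occSA occE // piE.
elim: h s => [|h IH] s hH /=; first by rewrite -dmu'.
rewrite /m dP //; apply: eq_bigr => s' _; apply: eq_bigr => a _.
by rewrite IH 1?ltnW // piE 1?ltnW.
Qed.

Let X : finType := ('I_H * S * A)%type.

(** Row vectors give access to compactness in finite dimension; steps from [H] on read as 0. *)
Definition flow_of_vec (v : 'rV[R]_#|X|) : nat -> S -> A -> R := fun h s a =>
  if insub h is Some i then v ord0 (enum_rank ((i, s, a) : X)) else 0.

Definition vec_of_flow (d : nat -> S -> A -> R) : 'rV[R]_#|X| :=
  \row_(k < #|X|) let x : X := enum_val k in d x.1.1 x.1.2 x.2.

Lemma vec_of_flowK d h s a : (h < H)%N -> flow_of_vec (vec_of_flow d) h s a = d h s a.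
Proof.
by move=> hH; rewrite /flow_of_vec insubT mxE /= enum_rankK.
Qed.

Lemma flow_of_vecD u v t h s a : flow_of_vec (u + t *: (v - u)) h s a =
  flow_of_vec u h s a + t * (flow_of_vec v h s a - flow_of_vec u h s a).
Proof.
by rewrite /flow_of_vec; case: insub => [i|]; rewrite ?mxE // subr0 mulr0 addr0.
Qed.

Lemma continuous_flow_of_vec h s a : continuous (fun v => flow_of_vec v h s a).
Proof.
rewrite /flow_of_vec; case: insub => [i|]; first exact: coord_continuous.
exact: cst_continuous.
Qed.

Definition flow_polytope := [set v | flow (flow_of_vec v)].

Lemma flow_polytope_occ pi : markov_policy H pi ->
  flow_polytope (vec_of_flow (occSA P mu pi)).
Proof.
move=> mpi; have [f1 f2 f3] := flow_occSA mpi; split.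
- by move=> h s a hH; rewrite vec_of_flowK // f1.
- by move=> H0 s; rewrite -f2 //; apply: eq_bigr => a _; rewrite vec_of_flowK.
- move=> h s hH; rewrite (eq_bigr (occSA P mu pi h.+1 s)); last first.
    by move=> a _; rewrite vec_of_flowK.
  rewrite f3 //; apply: eq_bigr => s' _; apply: eq_bigr => a _.
  by rewrite vec_of_flowK // ltnW.
Qed.

Lemma flow_polytope_convex u v t : flow_polytope u -> flow_polytope v ->
  0 <= t <= 1 -> flow_polytope (u + t *: (v - u)).
Proof.
move=> [u1 u2 u3] [v1 v2 v3] /andP[t0 t1]; split.
- move=> h s a hH; rewrite flow_of_vecD.
  have := u1 h s a hH; have := v1 h s a hH; nra.
- move=> H0 s; under eq_bigr do rewrite flow_of_vecD.
  by rewrite big_split /= -mulr_sumr sumrB u2 // v2 // subrr mulr0 addr0.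
- move=> h s hH; under eq_bigr do rewrite flow_of_vecD.
  under [RHS]eq_bigr do
    [under eq_bigr do rewrite flow_of_vecD mulrDl -mulrA mulrBl;
     rewrite big_split /= -mulr_sumr sumrB].
  by rewrite !big_split /= -!mulr_sumr !sumrB u3 // v3.
Qed.

(** A flow is realised by a policy, so its entries are probabilities. *)
Lemma flow_polytope_le1 v h s a : flow_polytope v -> flow_of_vec v h s a <= 1.
Proof.
move=> vD; have [pi mpi occE] := flow_policy vD.
have [hH|Hh] := ltnP h H; last by rewrite /flow_of_vec insubN ?ler01 // -leqNgt.
rewrite -occE // (le_trans (occSA_le _ _ mpi hH)) // occS_le1 // ltnW //.
Qed.

(** The constraints are equations and weak inequalities between continuous functions, so they cut a
    closed set out of the unit box. *)
Lemma flow_polytope_compact : compact flow_polytope.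
Proof.
have cbox : compact [set v : 'rV[R]_#|X| |
    forall i, `[0, 1]%classic (v ord0 i)].
  by apply: (@rV_compact R #|X| (fun=> `[0, 1]%classic)) => _; exact: segment_compact.
apply: (subclosed_compact _ cbox); last first.
  move=> v vD i; rewrite /= in_itv /=; have [v1 _ _] := vD.
  pose x : X := enum_val i.
  have e : v ord0 i = flow_of_vec v x.1.1 x.1.2 x.2.
    rewrite /flow_of_vec valK (_ : (x.1.1, x.1.2, x.2) = x) ?enum_valK //.
    by case: (x) => -[].
  by rewrite e v1 //= flow_polytope_le1.
have cflow := continuous_flow_of_vec.
have clE (f g : 'rV[R]_#|X| -> R) : continuous f -> continuous g ->
    closed [set v | f v = g v].
  move=> cf cg; rewrite (_ : mkset _ = (fun v => f v - g v) @^-1` [set 0]).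
    apply: closed_comp; last exact: closed_eq.
    by move=> v _; apply: continuousB; [exact: cf|exact: cg].
  by apply/seteqP; split=> v /= => [->|/eqP]; rewrite ?subrr // subr_eq0 => /eqP.
have cl_all (I : Type) (C : I -> set 'rV[R]_#|X|) : (forall i, closed (C i)) ->
    closed [set v | forall i, C i v].
  move=> cC; rewrite (_ : mkset _ = \bigcap_i C i); first exact: closed_bigI.
  by apply/seteqP; split=> v Cv i => [_|]; exact: Cv.
rewrite (_ : flow_polytope =
    [set v | forall h s a, (h < H)%N -> 0 <= flow_of_vec v h s a] `&`
    ([set v | (0 < H)%N -> forall s, \sum_a flow_of_vec v 0%N s a = mu s] `&`
     [set v | forall h s, (h.+1 < H)%N -> \sum_a flow_of_vec v h.+1 s a =
        \sum_s' \sum_a flow_of_vec v h s' a * P h s' a s])); last first.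
  by apply/seteqP; split=> v /= => [[? ? ?]|[? [? ?]]]; do ?split.
apply: closedI; [|apply: closedI].
- apply: (cl_all _ (fun h => [set v | _])) => h.
  apply: (cl_all _ (fun s => [set v | _])) => s.
  apply: (cl_all _ (fun a => [set v | _])) => a.
  apply: (cl_all _ (fun hH => [set v | _])) => hH.
  apply: (@closed_comp _ _ (fun v => flow_of_vec v h s a) [set x | 0 <= x]).
    by move=> v _; exact: cflow.
  exact: closed_ge.
- apply: (cl_all _ (fun h => [set v | _])) => H0.
  apply: (cl_all _ (fun s => [set v | _])) => s.
  by apply: clE; [exact: continuous_sum|exact: cst_continuous].
- apply: (cl_all _ (fun h => [set v | _])) => h.
  apply: (cl_all _ (fun s => [set v | _])) => s.
  apply: (cl_all _ (fun hH => [set v | _])) => hH.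
  apply: clE; first exact: continuous_sum.
  apply: continuous_sum => s'; apply: continuous_sum => a v.
  by apply: continuousM; [exact: (cflow h s' a v)|exact: cst_continuous].
Qed.

Definition linear_return (r : rew R S A) (v : 'rV[R]_#|X|) : R :=
  \sum_(h < H) \sum_s \sum_a flow_of_vec v h s a * r h s a.

Lemma linear_return_occ r v pi :
  (forall h s a, (h < H)%N -> occSA P mu pi h s a = flow_of_vec v h s a) ->
  linear_return r v = return_of pi r.
Proof.
move=> occE; apply: eq_bigr => h _; apply: eq_bigr => s _; apply: eq_bigr => a _.
by rewrite occE.
Qed.

Lemma continuous_linear_return r : continuous (linear_return r).
Proof.
apply: continuous_sum => h; apply: continuous_sum => s; apply: continuous_sum => a v.
by apply: continuousM; [exact: (@continuous_flow_of_vec h s a v)|exact: cst_continuous].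
Qed.

Lemma linear_returnD r u v t : linear_return r (u + t *: (v - u)) =
  linear_return r u + t * (linear_return r v - linear_return r u).
Proof.
rewrite /linear_return -sumrB mulr_sumr -big_split /=; apply: eq_bigr => h _.
rewrite -sumrB mulr_sumr -big_split /=; apply: eq_bigr => s _.
rewrite -sumrB mulr_sumr -big_split /=; apply: eq_bigr => a _.
rewrite flow_of_vecD; ring.
Qed.

Lemma flow_polytope_neq0 : flow_polytope !=set0.
Proof. by eexists; apply: flow_polytope_occ uniform_policyP. Qed.

(** The return is continuous on the compact polytope, and a maximiser there is realised by a
    policy. *)
Lemma optimal_policy r : exists2 pi, markov_policy H pi &
  forall pi', markov_policy H pi' -> return_of pi' r <= return_of pi r.
Proof.
have [v /set_mem vD vmax] : exists2 v, v \in flow_polytope &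
    forall u, u \in flow_polytope -> linear_return r u <= linear_return r v.
  apply: compact_EVT_max flow_polytope_neq0 flow_polytope_compact _.
  exact/continuous_subspaceT/continuous_linear_return.
have [pi mpi occE] := flow_policy vD; exists pi => // pi' mpi'.
rewrite -(linear_return_occ _ occE).
rewrite -(@linear_return_occ r (vec_of_flow (occSA P mu pi'))).
  by apply/vmax/mem_set/flow_polytope_occ.
by move=> h s a hH; rewrite vec_of_flowK.
Qed.

(** Returns are affine in the flow but not in the policy, so the duality is applied on the polytope
    and its solution turned back into a policy. It trades one policy per weighting for one policy
    that serves all targets. *)
Lemma policy_dominating (J : finType) (W : J -> rew R S A) (c : J -> R) :
  (forall rho : J -> R, (forall j, 0 <= rho j) -> exists2 pi, markov_policy H pi &
     \sum_j rho j * c j <= \sum_j rho j * return_of pi (W j)) ->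
  exists2 pi, markov_policy H pi & forall j, c j <= return_of pi (W j).
Proof.
move=> hyp.
have [v vD cv] : exists2 v, flow_polytope v & forall j, c j <= linear_return (W j) v.
  apply: compact_convex_dominating.
  - exact: flow_polytope_neq0.
  - exact: flow_polytope_compact.
  - by move=> j; exact: continuous_linear_return.
  - exact: flow_polytope_convex.
  - by move=> j; exact: linear_returnD.
  move=> rho /hyp[pi mpi le].
  exists (vec_of_flow (occSA P mu pi)); first exact: flow_polytope_occ.
  apply: le_trans le _; apply: ler_sum => j _.
  by rewrite (@linear_return_occ _ _ pi) // => h s a hH; rewrite vec_of_flowK.
have [pi mpi occE] := flow_policy vD; exists pi => // j.
by rewrite -(linear_return_occ _ occE).
Qed.

(** The return of this reward is an occupancy, which makes attainment of [occ_star] an instance of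
    [optimal_policy]. *)
Definition state_reward (h : nat) (s : S) : rew R S A :=
  fun h' s' _ => ((h' == h) && (s' == s))%:R.

Lemma return_state_reward pi h s : markov_policy H pi -> (h < H)%N ->
  return_of pi (state_reward h s) = occS P mu pi h s.
Proof.
move=> mpi hH; rewrite /return_of /state_reward (bigD1 (Ordinal hH)) //=.
rewrite [X in _ + X]big1 ?addr0 => [|i /eqP ih]; last first.
  apply: big1 => s' _; apply: big1 => a _.
  by case: eqP => [e|]; rewrite ?mulr0 //; case: ih; exact: val_inj.
rewrite (bigD1 s) //= [X in _ + X]big1 ?addr0 => [|s' /negPf s's]; last first.
  by apply: big1 => a _; rewrite s's andbF mulr0.
by rewrite -[RHS](sum_occSA _ mpi hH); apply: eq_bigr => a _; rewrite !eqxx mulr1.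
Qed.

Lemma occ_star_attained h s : (h < H)%N ->
  exists2 pi, markov_policy H pi & occ_star H P mu h s = occS P mu pi h s.
Proof.
move=> hH; have [pi mpi pimax] := optimal_policy (state_reward h s).
exists pi => //; apply/eqP; rewrite eq_le; apply/andP; split.
  apply: ge_sup; first by exists (occS P mu pi h s); exists pi.
  move=> _ [pi' mpi' <-].
  by have := pimax _ mpi'; rewrite !return_state_reward.
apply: ub_le_sup; last by exists pi.
by exists 1 => _ [pi' mpi' <-]; rewrite occS_le1 // ltnW.
Qed.

Lemma occS_le_star pi h s : markov_policy H pi -> (h < H)%N ->
  occS P mu pi h s <= occ_star H P mu h s.
Proof.
move=> mpi hH; apply: ub_le_sup; last by exists pi.
by exists 1 => _ [pi' mpi' <-]; rewrite occS_le1 // ltnW.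
Qed.

Lemma occ_star_ge0 h s : (h < H)%N -> 0 <= occ_star H P mu h s.
Proof.
move=> hH; apply: le_trans (occS_le_star s uniform_policyP hH).
exact: (occS_ge0 s uniform_policyP (ltnW hH)).
Qed.

End Occupancy.

(** * Finite probability spaces and product laws *)

Section FiniteProbability.
Variables (R : realType) (T : finType) (t0 : T) (p : T -> R).
Hypothesis dp : is_dist p.

(* The probability space is [nat], charging only the codes [n < #|T|] of the
   elements of [T]: it comes with a sigma-algebra for which all sets are
   measurable. *)
Definition outcome (n : nat) : T := nth t0 (enum T) n.

Definition atom_mass (n : nat) : {nonneg R} := NngNum (dp.1 (outcome n)).

Definition finite_law : set nat -> \bar R :=
  msum (fun n => mscale (atom_mass n) (@dirac _ nat n R)) #|T|.

HB.instance Definition _ := Measure.on finite_law.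

Lemma outcome_rank (t : T) : outcome (enum_rank t) = t.
Proof. exact: nth_enum_rank. Qed.

Lemma sum_outcome (F : T -> \bar R) :
  (\sum_(n < #|T|) F (outcome n) = \sum_t F t)%E.
Proof.
rewrite (reindex (@enum_rank T)) /=; last exact: onW_bij (@enum_rank_bij T).
by apply: eq_bigr => t _; rewrite outcome_rank.
Qed.

Lemma finite_lawE (Q : T -> Prop) :
  finite_law [set n | Q (outcome n)] = (\sum_t p t * `[< Q t >]%:R)%:E.
Proof.
rewrite -sumEFin -sum_outcome; apply: eq_bigr => n _ /=.
rewrite /mscale /= diracE EFinM; congr (_ * _)%E.
Qed.

Lemma finite_lawT : finite_law setT = 1%E.
Proof.
rewrite (_ : setT = [set n | (fun=> True) (outcome n)]); last exact/esym/seteqP.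
rewrite (finite_lawE (fun=> True)) asboolT //.
by under eq_bigr do rewrite mulr1; case: dp => _ ->.
Qed.

HB.instance Definition _ := Measure_isProbability.Build _ _ _ finite_law finite_lawT.

Lemma integral_finite_law (G : T -> R) : (forall t, 0 <= G t) ->
  (\int[finite_law]_n (G (outcome n))%:E = (\sum_t p t * G t)%:E)%E.
Proof.
move=> G0; rewrite ge0_integral_measure_sum //=; last by move=> n _; rewrite lee_fin.
rewrite -sumEFin -sum_outcome; apply: eq_bigr => n _.
rewrite ge0_integral_mscale //=; last by move=> m _; rewrite lee_fin.
by rewrite integral_dirac //= diracT mul1e.
Qed.

End FiniteProbability.

(** Once [G] is absorbed into the factor of coordinate [i], the sum of products splits into a
    product of sums, all others being total masses 1. *)
Lemma sum_ffun_prod_marginal (R : comPzRingType) (I K : finType) (q G : K -> R) (i : I) :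
  \sum_k q k = 1 ->
  \sum_(f : {ffun I -> K}) (\prod_j q (f j)) * G (f i) = \sum_k q k * G k.
Proof.
move=> q1.
rewrite (eq_bigr (fun f : {ffun I -> K} =>
    \prod_j (q (f j) * (if j == i then G (f j) else 1)))); last first.
  move=> f _; rewrite big_split /=; congr (_ * _).
  by rewrite -big_mkcond /= big_pred1_eq.
rewrite -(bigA_distr_bigA (fun j k => q k * (if j == i then G k else 1))) (bigD1 i) //= eqxx.
rewrite [X in _ * X]big1 ?mulr1 // => j /negPf ->.
by under eq_bigr do rewrite mulr1.
Qed.

(** It will bound from below the probability that no ticket wins in the other [H.-1] steps. *)
Lemma bernoulli_inequality (R : realDomainType) (x : R) n :
  0 <= x <= 1 -> 1 - n%:R * x <= (1 - x) ^+ n.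
Proof.
move=> x01; elim: n => [|n IH]; first by rewrite mul0r subr0 expr0.
rewrite exprS -natr1.
have : (1 - x) * (1 - n%:R * x) <= (1 - x) * (1 - x) ^+ n by rewrite ler_wpM2l //; lra.
have : 0 <= n%:R * x ^+ 2 by rewrite mulr_ge0 // sqr_ge0.
nra.
Qed.

Lemma prodr_asbool (R : comPzSemiRingType) n (Q : nat -> Prop) :
  \prod_(h < n) (`[< Q h >]%:R : R) = `[< forall h, (h < n)%N -> Q h >]%:R.
Proof.
case: (asboolP (forall h, _)) => [allQ|nQ].
  by rewrite big1 // => h _; rewrite asboolT //; exact: allQ.
have [i nQi] : exists i : 'I_n, ~ Q i.
  apply: contrapT => /forallNP allQ; apply: nQ => h hn.
  exact: (contrapT (allQ (Ordinal hn))).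
by rewrite (bigD1 i) //= asboolF // mul0r.
Qed.

(** * Long-shot rewards and the policy chasing them *)

Section LongShot.
Variables (R : realType) (S A : finType) (H : nat) (r : rew R S A) (eps : R).
Hypotheses (r0 : forall h s a, (h < H)%N -> 0 <= r h s a).
Hypotheses (eps0 : 0 < eps) (eps1 : #|{: S * A}|%:R * eps <= 1).

Let K : finType := option (S * A).
Let T : finType := {ffun 'I_H -> K}.

(* At each step independently, each entry of the reward vector wins the prize
   [r / eps] with probability [eps], at most one entry winning per step. *)
Definition ticket (k : K) : R :=
  if k is Some _ then eps else 1 - #|{: S * A}|%:R * eps.

Lemma ticket_dist : is_dist ticket.
Proof.
split=> [[x|] /=|]; [exact: ltW|by rewrite subr_ge0|].
rewrite (bigD1 (None : K)) //= (eq_bigr (fun=> eps)); last by case.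
by rewrite sumr_const cardC1 card_option /= -[eps *+ _]mulr_natl subrK.
Qed.

Definition draw_mass (f : T) : R := \prod_i ticket (f i).

Lemma draw_mass_dist : is_dist draw_mass.
Proof.
split=> [f|]; first by apply: prodr_ge0 => i _; exact: ticket_dist.1.
rewrite /draw_mass -(bigA_distr_bigA (fun=> ticket)) big1 // => i _.
exact: ticket_dist.2.
Qed.

Definition prize (h : nat) (k : K) (s : S) (a : A) : R :=
  if k == Some (s, a) then r h s a / eps else 0.

Definition payoff (f : T) : rew R S A := fun h =>
  if insub h is Some i then prize h (f i) else fun _ _ => 0.

Lemma payoffE f (i : 'I_H) : payoff f i = prize i (f i).
Proof. by rewrite /payoff valK. Qed.

Lemma payoff_ge0 f h s a : 0 <= payoff f h s a.
Proof.
rewrite /payoff; case: insubP => // i hH _; rewrite /prize; case: eqP => // _.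
by rewrite divr_ge0 ?r0 // ltW.
Qed.

Let t0 : T := [ffun => None].
Definition longshot_law : probability nat R := finite_law t0 draw_mass_dist.

Definition longshot (h : nat) (s : S) (a : A) (om : nat) : R :=
  payoff (outcome t0 om) h s a.

(** The event at step [h] depends on the ticket of that step only, so mass times indicator is a
    product over steps and the sum over draws factors into marginals. *)
Lemma longshot_independent (B : nat -> set (S -> A -> R)) :
  fine (longshot_law [set om | forall h, (h < H)%N -> B h (rvec longshot h om)])
  = \prod_(h < H) fine (longshot_law [set om | B h (rvec longshot h om)]).
Proof.
pose b (i : 'I_H) (k : K) := `[< B i (prize i k) >].
rewrite /longshot_law /=.
rewrite (finite_lawE t0 draw_mass_dist (fun f => forall h, (h < H)%N -> B h (payoff f h))) /=.
rewrite (eq_bigr (fun f : T => \prod_i (ticket (f i) * (b i (f i))%:R))); last first.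
  move=> f _; rewrite big_split /=; congr (_ * _).
  rewrite -(prodr_asbool R H (fun h => B h (payoff f h))).
  by apply: eq_bigr => i _; rewrite /b -payoffE.
rewrite -(bigA_distr_bigA (fun i k => ticket k * (b i k)%:R)); apply: eq_bigr => i _.
rewrite (finite_lawE t0 draw_mass_dist (fun f => B i (payoff f i))) /=.
rewrite -(sum_ffun_prod_marginal (fun k => (b i k)%:R) i ticket_dist.2).
by apply: eq_bigr => f _; rewrite payoffE.
Qed.

Lemma longshot_reward_dist : reward_dist H r longshot_law longshot.
Proof.
split=> [h s a hH|h s a om _|h s a hH|B _].
- by [].
- exact: payoff_ge0.
- rewrite (integral_finite_law t0 draw_mass_dist (fun f => payoff_ge0 f h s a)).
  congr (_%:E); rewrite -[h]/(nat_of_ord (Ordinal hH)); set i := Ordinal hH.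
  under eq_bigr do rewrite payoffE.
  rewrite (sum_ffun_prod_marginal (fun k => prize i k s a) i ticket_dist.2).
  rewrite (bigD1 (Some (s, a))) //= big1 ?addr0 => [|k /negPf kN].
    by rewrite /prize eqxx mulrC divfK // gt_eqF.
  by rewrite /prize kN mulr0.
- exact: longshot_independent.
Qed.

(** The lower bound on the value counts only these draws; all others contribute non-negatively. *)
Definition single_win (x : 'I_H * S * A) : T :=
  [ffun i => if i == x.1.1 then Some (x.1.2, x.2) else None].

Lemma single_win_inj : injective single_win.
Proof.
move=> [[h s] a] [[h' s'] a'] /ffunP /(_ h); rewrite !ffunE /= eqxx.
by case: eqP => [-> [-> ->]|].
Qed.

Lemma single_win_mass x :
  draw_mass (single_win x) = eps * (1 - #|{: S * A}|%:R * eps) ^+ H.-1.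
Proof.
rewrite /draw_mass (bigD1 x.1.1) //= ffunE eqxx /=; congr (_ * _).
rewrite (eq_bigr (fun=> 1 - #|{: S * A}|%:R * eps)) => [|i /negPf ix]; last first.
  by rewrite ffunE ix.
by rewrite prodr_const cardC1 card_ord.
Qed.

Lemma payoff_single_win x (h : 'I_H) s a : payoff (single_win x) h s a =
  if (h, s, a) == x then r h s a / eps else 0.
Proof.
case: x => [[h' s'] a']; rewrite payoffE /prize ffunE /= !xpair_eqE.
case: (h =P h') => //= _; case: eqP => [[-> ->]|ne]; first by rewrite !eqxx.
by case: eqP => //= e1; case: eqP => //= e2; case: ne; rewrite e1 e2.
Qed.

Variables (P : nat -> S -> A -> S -> R) (mu : S -> R).
Hypotheses (kP : is_kernel H P) (dmu : is_dist mu) (HA : (0 < #|A|)%N).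

(* An agent seeing the whole future heads for the first announced prize
   (the only one, when a single ticket wins) along a policy maximising the
   probability of being in the right state at the right time. *)
Variable target : nat -> S -> nat -> S -> A -> R.
Hypothesis target_policy : forall h s, (h < H)%N -> markov_policy H (target h s).
Hypothesis target_occ : forall h s, (h < H)%N ->
  occ_star H P mu h s = occS P mu (target h s) h s.

(** Searching from step [h] on keeps the choice within the window that full lookahead allows at step
    [h]. *)
Definition announced (h : nat) (w : rew R S A) : option ('I_H * S * A) :=
  [pick x : 'I_H * S * A | (h <= x.1.1)%N && (w x.1.1 x.1.2 x.2 != 0)].

Definition chasing_policy (h : nat) (s : S) (w : rew R S A) : A -> R :=
  match announced h w with
  | Some x => if (h < x.1.1)%N then target x.1.1 x.1.2 h s else fun a => (a == x.2)%:R
  | None => @uniform_policy R S A h s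
  end.

Lemma chasing_policyP : lookahead_policy H H chasing_policy.
Proof.
split=> [h s w hH|h s w w' hH ww'].
  rewrite /chasing_policy; case: announced => [x|].
    case: ifP => _; first exact: target_policy.
    exact: is_dist_indicator.
  exact: (@uniform_policyP R S A H HA h hH s).
rewrite /chasing_policy /announced (@eq_pick _ _
  (fun x : 'I_H * S * A => (h <= x.1.1)%N && (w' x.1.1 x.1.2 x.2 != 0))) //.
move=> x /=; case: leqP => //= hx; rewrite ww' // hx leq_min ltn_ord andbT.
by rewrite (leq_trans (ltn_ord _)) // leq_addl.
Qed.

(** With a single nonzero prize the announcement is the same at every step up to the prize, so the
    agent follows one [target] policy throughout and plays the paying action on arrival. *)
Lemma chasing_single_win (x : 'I_H * S * A) : r x.1.1 x.1.2 x.2 != 0 ->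
  occSA P mu (fun t s' => chasing_policy t s' (payoff (single_win x))) x.1.1 x.1.2 x.2
  = occ_star H P mu x.1.1 x.1.2.
Proof.
move=> rx.
have ann h : (h <= x.1.1)%N -> announced h (payoff (single_win x)) = Some x.
  move=> hx; rewrite /announced; case: pickP => [y|/(_ x)].
    rewrite payoff_single_win -!surjective_pairing.
    by case: (y =P x) => [->|_] //; rewrite eqxx andbF.
  rewrite payoff_single_win -!surjective_pairing eqxx hx /=.
  by rewrite mulf_neq0 // invr_neq0 // gt_eqF.
rewrite /occSA {2}/chasing_policy ann // ltnn eqxx mulr1.
rewrite target_occ //; congr (_ _); apply: eq_occS => t tx.
by apply: funext => s; rewrite /chasing_policy ann ?tx // ltnW.
Qed.

(** A single win at an entry has probability [eps] times the power on the left, and its prize is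
    [r / eps]: the factors [eps] cancel, leaving [occ_star * r] for each entry. *)
Lemma longshot_value :
  (((1 - #|{: S * A}|%:R * eps) ^+ H.-1 *
    \sum_(h < H) \sum_s \sum_a occ_star H P mu h s * r h s a)%:E
  <= value H P mu longshot_law longshot chasing_policy)%E.
Proof.
pose G (f : T) := \sum_(h < H) \sum_s \sum_a
  occSA P mu (fun t s' => chasing_policy t s' (payoff f)) h s a * payoff f h s a.
have mchase (f : T) : markov_policy H (fun t s' => chasing_policy t s' (payoff f)).
  by move=> h hH s; exact: chasing_policyP.1.
have term0 (f : T) (h : 'I_H) s a : 0 <=
    occSA P mu (fun t s' => chasing_policy t s' (payoff f)) h s a * payoff f h s a.
  by rewrite mulr_ge0 ?payoff_ge0 // (occSA_ge0 kP dmu).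
have G0 f : 0 <= G f.
  by apply: sumr_ge0 => h _; apply: sumr_ge0 => s _; apply: sumr_ge0 => a _.
rewrite /value (integral_finite_law t0 draw_mass_dist G0) lee_fin.
apply: le_trans (_ : \sum_(f in [set single_win x | x : 'I_H * S * A]%SET) draw_mass f * G f <= _).
  rewrite big_imset /=; last by move=> x y _ _; exact: single_win_inj.
  rewrite mulr_sumr.
  rewrite (eq_bigr (fun h : 'I_H => \sum_s \sum_a
      (1 - #|{: S * A}|%:R * eps) ^+ H.-1 * (occ_star H P mu h s * r h s a))); last first.
    by move=> h _; rewrite mulr_sumr; apply: eq_bigr => s _; rewrite mulr_sumr.
  under eq_bigr do rewrite pair_big /=.
  rewrite pair_big /=.
  rewrite (reindex (fun x : 'I_H * S * A => (x.1.1, (x.1.2, x.2)))) /=; last first.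
    by exists (fun y => (y.1, y.2.1, y.2.2)) => [[[? ?] ?]|[? [? ?]]].
  apply: ler_sum => x _; rewrite single_win_mass.
  have c0 : 0 <= 1 - #|{: S * A}|%:R * eps by rewrite subr_ge0.
  (* A prize of mean 0 is never announced, but its benchmark term is 0 too. *)
  have [rx|rx] := eqVneq (r x.1.1 x.1.2 x.2) 0.
    by rewrite rx !mulr0 mulr_ge0 // mulr_ge0 ?exprn_ge0 // ltW.
  have : occ_star H P mu x.1.1 x.1.2 * (r x.1.1 x.1.2 x.2 / eps) <= G (single_win x).
    rewrite -(chasing_single_win rx) /G.
    rewrite (bigD1 x.1.1) //= (bigD1 x.1.2) //= (bigD1 x.2) //=.
    rewrite payoff_single_win -!surjective_pairing eqxx -!addrA lerDl !addr_ge0 //.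
    + by apply: sumr_ge0 => a _.
    + by apply: sumr_ge0 => s _; apply: sumr_ge0 => a _.
    + by apply: sumr_ge0 => h _; apply: sumr_ge0 => s _; apply: sumr_ge0 => a _.
  set c := (1 - _) ^+ _ => le.
  have c0' : 0 <= eps * c by rewrite mulr_ge0 ?exprn_ge0 // ltW.
  apply: le_trans (ler_wpM2l c0' le); rewrite le_eqVlt; apply/orP; left.
  by apply/eqP; field; rewrite gt_eqF.
rewrite [leRHS](bigID (fun f => f \in [set single_win x | x : 'I_H * S * A]%SET)) /= lerDl.
by apply: sumr_ge0 => f _; rewrite mulr_ge0 // draw_mass_dist.1.
Qed.

End LongShot.

(* No measurability is needed, the integral of a non-negative function being a
   supremum over the simple functions below it; policies that look ahead are not
   assumed measurable. *)
Lemma ge0_le_integralT d (T : measurableType d) (R : realType)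
    (nu : {measure set T -> \bar R}) (f g : T -> \bar R) :
  (forall x, 0 <= f x)%E -> (forall x, f x <= g x)%E ->
  (\int[nu]_x f x <= \int[nu]_x g x)%E.
Proof.
move=> f0 fg; have g0 x : (0 <= g x)%E by exact: le_trans (f0 x) (fg x).
rewrite !ge0_integralTE //; apply: le_ereal_sup => _ [h hf <-].
by exists h => // x; exact: le_trans (hf x) (fg x).
Qed.

(** * The worst reward distribution for given means *)

Section WorstCaseDistribution.
Variables (R : realType) (S A : finType) (H : nat).
Variables (P : nat -> S -> A -> S -> R) (mu : S -> R).
Hypotheses (kP : is_kernel H P) (dmu : is_dist mu) (HH : (0 < H)%N) (HA : (0 < #|A|)%N).

Definition benchmark (r : rew R S A) : R :=
  \sum_(h < H) \sum_s \sum_a occ_star H P mu h s * r h s a.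

Lemma benchmark_ge0 r : (forall h s a, (h < H)%N -> 0 <= r h s a) -> 0 <= benchmark r.
Proof.
move=> r0; apply: sumr_ge0 => h _; apply: sumr_ge0 => s _; apply: sumr_ge0 => a _.
by rewrite mulr_ge0 ?r0 //; exact: (occ_star_ge0 kP dmu HA).
Qed.

Lemma return_ge0 r pi : (forall h s a, (h < H)%N -> 0 <= r h s a) ->
  markov_policy H pi -> 0 <= return_of H P mu pi r.
Proof.
move=> r0 mpi; apply: sumr_ge0 => h _; apply: sumr_ge0 => s _; apply: sumr_ge0 => a _.
by rewrite mulr_ge0 ?r0 //; exact: (occSA_ge0 kP dmu).
Qed.

Section RewardDistribution.
Variables (r : rew R S A) (d : measure_display) (Omega : measurableType d).
Variables (Pr : probability Omega R) (X : nat -> S -> A -> Omega -> R).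
Hypothesis rX : reward_dist H r Pr X.

Lemma mean_linear_reward (c : nat -> S -> A -> R) :
  (forall h s a, (h < H)%N -> 0 <= c h s a) ->
  (\int[Pr]_om (\sum_(h < H) \sum_s \sum_a c h s a * X h s a om)%:E
   = (\sum_(h < H) \sum_s \sum_a c h s a * r h s a)%:E)%E.
Proof.
case: rX => mX X0 EX _ c0.
transitivity (\int[Pr]_om (\sum_(x : 'I_H * (S * A))
    (c x.1 x.2.1 x.2.2)%:E * (X x.1 x.2.1 x.2.2 om)%:E))%E.
  apply: eq_integral => om _; under eq_bigr do rewrite pair_big /=.
  by rewrite pair_big /= -sumEFin.
rewrite ge0_integral_sum //=; first last.
- by move=> x om _; rewrite -EFinM lee_fin mulr_ge0 ?c0 ?X0.
- by move=> x; apply: measurable_funeM; apply/measurable_EFinP; exact: mX.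
under [in RHS]eq_bigr do rewrite pair_big /=.
rewrite pair_big /= -sumEFin; apply: eq_bigr => x _.
rewrite ge0_integralZl ?lee_fin ?c0 //=; first last.
- by move=> om _; rewrite lee_fin X0.
- by apply/measurable_EFinP; exact: mX.
by rewrite EX // EFinM.
Qed.

(** The window is empty, so the decision rule is the same for all realisations and may be read off
    at the zero reward; the expectation then only sees the means. *)
Lemma value_blind pi : lookahead_policy H 0 pi -> value H P mu Pr X pi
  = (return_of H P mu (fun h s => pi h s (fun _ _ _ => 0)) r)%:E.
Proof.
move=> [dpi blind].
have mpi : markov_policy H (fun h s => pi h s (fun _ _ _ => 0)) by move=> h hH s; exact: dpi.
rewrite /value /return_of -mean_linear_reward => [|h s a hH]; last first.
  exact: (occSA_ge0 kP dmu).
apply: eq_integral => om _; congr (_%:E); apply: eq_bigr => h _.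
apply: eq_bigr => s _; apply: eq_bigr => a _; congr (_ * _).
have blindE t s' : (t < H)%N ->
    pi t s' (fun t'' => rvec X t'' om) = pi t s' (fun _ _ _ => 0).
  move=> tH; apply: blind => // u /andP[tu]; rewrite addn0 leq_min => /andP[ut _].
  by move: (leq_ltn_trans tu ut); rewrite ltnn.
rewrite /occSA blindE //; congr (_ * _); congr (_ _); apply: eq_occS => t th.
by apply: funext => s'; rewrite blindE // (ltn_trans th).
Qed.

Lemma value_ge0 L pi : lookahead_policy H L pi -> (0 <= value H P mu Pr X pi)%E.
Proof.
case: rX => _ X0 _ _ [dpi _]; apply: integral_ge0 => om _; rewrite lee_fin.
apply: sumr_ge0 => h _; apply: sumr_ge0 => s _; apply: sumr_ge0 => a _.
rewrite mulr_ge0 ?X0 //; apply: (occSA_ge0 kP dmu) => // t tH s'; exact: dpi.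
Qed.

(** For each fixed realisation the lookahead policy is a Markovian one, whose occupancies lie below
    [occ_star]. *)
Lemma value_le_benchmark L pi :
  lookahead_policy H L pi -> (value H P mu Pr X pi <= (benchmark r)%:E)%E.
Proof.
case: (rX) => _ X0 _ _ [dpi _].
have mpi om : markov_policy H (fun t s' => pi t s' (fun t'' => rvec X t'' om)).
  by move=> t tH s'; exact: dpi.
rewrite /benchmark -(mean_linear_reward (c := fun h s _ => occ_star H P mu h s)) => [|h s a hH]; last first.
  exact: (occ_star_ge0 kP dmu HA).
apply: ge0_le_integralT => om; rewrite lee_fin.
  apply: sumr_ge0 => h _; apply: sumr_ge0 => s _; apply: sumr_ge0 => a _.
  by rewrite mulr_ge0 ?X0 //; exact: (occSA_ge0 kP dmu).
apply: ler_sum => h _; apply: ler_sum => s _; apply: ler_sum => a _.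
rewrite ler_wpM2r ?X0 //.
apply: le_trans (occSA_le kP dmu _ _ (mpi om) (ltn_ord h)) _.
exact: (occS_le_star kP dmu _ (mpi om) (ltn_ord h)).
Qed.

Lemma Vstar_blind pi : markov_policy H pi ->
  (forall pi', markov_policy H pi' -> return_of H P mu pi' r <= return_of H P mu pi r) ->
  Vstar H 0 P mu Pr X = (return_of H P mu pi r)%:E.
Proof.
move=> mpi pimax; apply/eqP; rewrite eq_le; apply/andP; split.
  apply: ge_ereal_sup => _ [pi' lpi' <-]; rewrite value_blind // lee_fin pimax //.
  by move=> h hH s; exact: lpi'.1.
have lpi : lookahead_policy H 0 (fun h s _ => pi h s).
  by split=> // h s _ hH; exact: mpi.
by apply: ereal_sup_ubound; exists (fun h s _ => pi h s) => //; rewrite value_blind.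
Qed.

(** [ediv] applies [fine] to both values, which is faithful for finite ones only. *)
Lemma Vstar_fin L : {v : R | Vstar H L P mu Pr X = v%:E & 0 <= v <= benchmark r}.
Proof.
have V0 : (0 <= Vstar H L P mu Pr X)%E.
  have lu : lookahead_policy H L (fun h s _ => @uniform_policy R S A h s).
    by split=> // h s _ hH; exact: (@uniform_policyP R S A H HA h hH s).
  apply: le_trans (value_ge0 lu) _; apply: ereal_sup_ubound.
  by exists (fun h s _ => @uniform_policy R S A h s).
have Vb : (Vstar H L P mu Pr X <= (benchmark r)%:E)%E.
  by apply: ge_ereal_sup => _ [pi lpi <-]; exact: (value_le_benchmark lpi).
case: (Vstar _ _ _ _ _ _) V0 Vb => // v; rewrite !lee_fin => v0 vb.
by exists v => //; rewrite v0.
Qed.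

End RewardDistribution.

Lemma benchmark_approached (r : rew R S A) (eta : R) :
  (forall h s a, (h < H)%N -> 0 <= r h s a) -> 0 < eta < 1 ->
  exists (d : measure_display) (Omega : measurableType d)
    (Pr : probability Omega R) (X : nat -> S -> A -> Omega -> R),
  reward_dist H r Pr X /\ (((1 - eta) * benchmark r)%:E <= Vstar H H P mu Pr X)%E.
Proof.
move=> r0 /andP[eta0 eta1].
have b0 := benchmark_ge0 r0.
pose N : R := #|{: S * A}|%:R.
have N0 : 0 <= N by rewrite ler0n.
(* This gives [H * N * eps <= eta], so that Bernoulli's inequality leaves a factor of at least
   [1 - eta]; the [+ 1] makes the denominator positive. *)
pose eps := eta / (N * H%:R + 1).
have NH0 : 0 < N * H%:R + 1 by rewrite ltr_wpDl // mulr_ge0.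
have eps0 : 0 < eps by rewrite divr_gt0.
have epsE : (N * H%:R + 1) * eps = eta by rewrite mulrC divfK // gt_eqF.
have HNe : H%:R * (N * eps) <= eta.
  by rewrite -epsE mulrDl mulrA [H%:R * N]mulrC lerDl mul1r ltW.
have H1 : 1 <= H%:R :> R by rewrite ler1n.
have Ne0 : 0 <= N * eps by rewrite mulr_ge0 // ltW.
have Ne : N * eps <= eta by apply: le_trans HNe; rewrite ler_peMl.
have Ne1 : N * eps <= 1 by lra.
have /choice[tg tgP] (hs : nat * S) : exists pi, (hs.1 < H)%N ->
    markov_policy H pi /\ occ_star H P mu hs.1 hs.2 = occS P mu pi hs.1 hs.2.
  have [hH|hH] := ltnP hs.1 H; last by exists (@uniform_policy R S A).
  by have [pi mpi e] := occ_star_attained kP dmu HA hs.2 hH; exists pi.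
pose target h s := tg (h, s).
have mtarget h s : (h < H)%N -> markov_policy H (target h s) by move=> /(tgP (h, s))[].
have occ_target h s : (h < H)%N -> occ_star H P mu h s = occS P mu (target h s) h s.
  by move=> /(tgP (h, s))[].
exists default_measure_display, nat, (longshot_law H eps0 Ne1), (longshot H r eps).
split; first exact: longshot_reward_dist.
have le1 : (((1 - eta) * benchmark r)%:E <= value H P mu (longshot_law H eps0 Ne1)
    (longshot H r eps) (chasing_policy H target))%E.
  apply: le_trans (longshot_value r0 eps0 Ne1 kP dmu HA mtarget occ_target).
  rewrite lee_fin ler_wpM2r //.
  have Ne01 : 0 <= N * eps <= 1 by rewrite Ne0.
  apply: le_trans (bernoulli_inequality H.-1 Ne01); rewrite lerD2l lerN2.
  by apply: le_trans HNe; rewrite ler_wpM2r // ler_nat leq_pred.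
apply: (le_trans le1); apply: ereal_sup_ubound; exists (chasing_policy H target) => //.
exact: chasing_policyP.
Qed.

(** The numerator is the same for all distributions with means [r]. The denominator never exceeds
    the benchmark and comes arbitrarily close to it. *)
Lemma CR_eq (r : rew R S A) pi :
  (forall h s a, (h < H)%N -> 0 <= r h s a) -> markov_policy H pi ->
  (forall pi', markov_policy H pi' -> return_of H P mu pi' r <= return_of H P mu pi r) ->
  CR H H P mu r = ediv (return_of H P mu pi r)%:E (benchmark r)%:E.
Proof.
move=> r0 mpi pimax.
have b0 := benchmark_ge0 r0.
have J0 := return_ge0 r0 mpi.
set J := return_of H P mu pi r in J0 *; set b := benchmark r in b0 *.
apply/eqP; rewrite eq_le; apply/andP; split; last first.
  apply: le_ereal_inf_tmp => x [d [U [Pr [X [rX ->]]]]].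
  rewrite (Vstar_blind rX mpi pimax).
  have [v -> /andP[v0 vb]] := Vstar_fin rX H.
  rewrite /ediv !eqe; have [_|vN0] := eqVneq v 0; first by rewrite leey.
  have v_gt0 : 0 < v by rewrite lt_def vN0.
  rewrite gt_eqF ?(lt_le_trans v_gt0) //= lee_fin ler_wpM2l //.
  by rewrite lef_pV2 ?posrE // (lt_le_trans v_gt0).
rewrite /ediv eqe; have [_|bN0] := eqVneq b 0; first by rewrite leey.
have b_gt0 : 0 < b by rewrite lt_def bN0.
apply/lee_addgt0Pr => e e0 /=.
(* Chosen so that [eta * (J + e * b) <= e * b], which is [J <= (J / b + e) * ((1 - eta) * b)]; the
   [+ 1] keeps [eta < 1] even if [J = 0]. *)
pose eta := e * b / (J + e * b + 1).
have eb0 : 0 < e * b by rewrite mulr_gt0.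
have eta01 : 0 < eta < 1 by rewrite divr_gt0 ?ltr_pdivrMr //; lra.
have [d [U [Pr [X [rX le]]]]] := benchmark_approached r0 eta01.
apply: (@le_trans _ _ (ediv (Vstar H 0 P mu Pr X) (Vstar H H P mu Pr X))).
  by apply: ereal_inf_lbound; exists d, U, Pr, X.
rewrite (Vstar_blind rX mpi pimax) -/J.
have [v ve _] := Vstar_fin rX H; move: le; rewrite ve lee_fin -/b => le.
have etaE : eta * (J + e * b + 1) = e * b by rewrite divfK // gt_eqF //; lra.
have v0 : 0 < v by apply: lt_le_trans le; rewrite mulr_gt0 //; lra.
rewrite /ediv eqe gt_eqF //= lee_fin ler_pdivrMr //.
have h1 : J + e * b = (J / b + e) * b by rewrite mulrDl divfK // gt_eqF.
have Jb : 0 <= J / b by rewrite divr_ge0 // ltW.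
apply: le_trans (_ : (J / b + e) * ((1 - eta) * b) <= _); last by rewrite ler_wpM2l //; lra.
rewrite mulrCA -h1; nra.
Qed.

End WorstCaseDistribution.

(** * Formulas and lower bounds for the competitive ratio *)

Section CompetitiveRatio.
Variables (R : realType) (S A : finType) (H : nat).
Variables (P : nat -> S -> A -> S -> R) (mu : S -> R).
Hypotheses (kP : is_kernel H P) (dmu : is_dist mu) (HH : (0 < H)%N) (HA : (0 < #|A|)%N).

Let J := return_of H P mu.
Let b := benchmark H P mu.

(** Clearing the denominator respects the convention on division by zero: for [y = 0] both sides
    hold. *)
Lemma le_ediv (c x y : R) : 0 <= x -> 0 <= y ->
  (c%:E <= ediv x%:E y%:E)%E <-> c * y <= x.
Proof.
move=> x0 y0; rewrite /ediv eqe; have [->|yN0] := eqVneq y 0.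
  by rewrite mulr0 leey x0.
by rewrite /= lee_fin ler_pdivlMr // lt_def yN0.
Qed.

Lemma CR_is_max r : (forall h s a, (h < H)%N -> 0 <= r h s a) ->
  is_max (markov_policy H) (fun pi => ediv (J pi r)%:E (b r)%:E) (CR H H P mu r).
Proof.
move=> r0; have [pi mpi pimax] := optimal_policy kP dmu HA r.
rewrite (CR_eq kP dmu HH HA r0 mpi pimax); split; first by exists pi.
move=> pi' mpi'; rewrite /ediv eqe; case: ifP => // _.
by rewrite /= lee_fin ler_wpM2r ?invr_ge0 ?(benchmark_ge0 kP dmu HA) // pimax.
Qed.

(** In this division-free form the condition on a fixed policy is linear in [r], hence passes to
    combinations of means. *)
Lemma CR_geP r (c : R) : (forall h s a, (h < H)%N -> 0 <= r h s a) ->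
  (c%:E <= CR H H P mu r)%E <-> exists2 pi, markov_policy H pi & c * b r <= J pi r.
Proof.
move=> r0; have [[pi mpi <-] pimax] := CR_is_max r0.
split=> [/le_ediv le|[pi' mpi' le]].
  by exists pi => //; apply: le; [exact: (return_ge0 kP dmu)|exact: (benchmark_ge0 kP dmu HA)].
apply: le_trans (pimax _ mpi'); apply/le_ediv => //; [exact: (return_ge0 kP dmu)|exact: (benchmark_ge0 kP dmu HA)].
Qed.

Section LinearCombination.
Variables (I : finType) (W : I -> rew R S A) (rho : I -> R).

Lemma sum_linear_combination (c : nat -> S -> A -> R) r :
  (forall h s a, (h < H)%N -> r h s a = \sum_j rho j * W j h s a) ->
  \sum_(h < H) \sum_s \sum_a c h s a * r h s a =
  \sum_j rho j * (\sum_(h < H) \sum_s \sum_a c h s a * W j h s a).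
Proof.
move=> rE; under [RHS]eq_bigr do rewrite mulr_sumr.
rewrite [RHS]exchange_big; apply: eq_bigr => h _ /=.
under [RHS]eq_bigr do rewrite mulr_sumr.
rewrite [RHS]exchange_big; apply: eq_bigr => s _ /=.
under [RHS]eq_bigr do rewrite mulr_sumr.
rewrite [RHS]exchange_big; apply: eq_bigr => a _ /=.
by rewrite rE // mulr_sumr; apply: eq_bigr => j _; rewrite mulrCA.
Qed.

End LinearCombination.

(* For a fixed policy, the worst mean in the cone spanned by the [W j] is one of
   the [W j]; duality exchanges this minimum with the maximum over policies. *)
Lemma worst_means_is_max (I : finType) (W : I -> rew R S A) (Q : set (rew R S A))
    (F : (nat -> S -> A -> R) -> \bar R) :
  (forall j h s a, (h < H)%N -> 0 <= W j h s a) ->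
  (exists j, 0 < b (W j)) ->
  (forall r, Q r -> exists2 rho : I -> R, (forall j, 0 <= rho j) &
     forall h s a, (h < H)%N -> r h s a = \sum_j rho j * W j h s a) ->
  (forall rho : I -> R, (forall j, 0 <= rho j <= 1) ->
     exists2 r, Q r &
     forall h s a, (h < H)%N -> r h s a = \sum_j rho j * W j h s a) ->
  (forall pi c, markov_policy H pi ->
     (c <= F pi)%E <-> forall j, (c <= ediv (J pi (W j))%:E (b (W j))%:E)%E) ->
  is_max (markov_policy H) F (ereal_inf [set CR H H P mu r | r in Q]).
Proof.
move=> W0 [j0 bj0] Qcone coneQ FP.
set v := ereal_inf _.
have comb0 rho r : (forall j, 0 <= rho j) ->
    (forall h s a, (h < H)%N -> r h s a = \sum_j rho j * W j h s a) ->
    forall h s a, (h < H)%N -> 0 <= r h s a.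
  by move=> rho0 rE h s a hH; rewrite rE //; apply: sumr_ge0 => j _; rewrite mulr_ge0 ?W0.
(* Easy half: a ratio guaranteed on every generator is guaranteed on the whole cone. *)
have upper pi : markov_policy H pi -> (F pi <= v)%E.
  move=> mpi; have Fj := (FP pi (F pi) mpi).1 (lexx _).
  have F0 : (0 <= F pi)%E.
    by apply/FP => // j; apply/le_ediv; rewrite ?mul0r ?(benchmark_ge0 kP dmu HA) ?(return_ge0 kP dmu) //; exact: W0.
  have Foo : (F pi < +oo)%E.
    by apply: le_lt_trans (Fj j0) _; rewrite /ediv eqe gt_eqF // ltry.
  case: (F pi) F0 Foo Fj => // c c0 _ cj.
  apply: le_ereal_inf_tmp => _ [r Qr <-]; have [rho rho0 rE] := Qcone r Qr.
  apply/CR_geP; first exact: comb0 rho0 rE.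
  exists pi => //; rewrite /b /benchmark /J /return_of.
  rewrite (sum_linear_combination (fun h s _ => occ_star H P mu h s) rE).
  rewrite (sum_linear_combination (occSA P mu pi) rE) mulr_sumr.
  apply: ler_sum => j _; rewrite mulrCA ler_wpM2l //.
  by apply/le_ediv; [apply: (return_ge0 kP dmu) => //; exact: W0|apply: (benchmark_ge0 kP dmu HA); exact: W0|exact: cj].
have v0 : (0 <= v)%E.
  apply: le_ereal_inf_tmp => _ [r Qr <-]; have [rho rho0 rE] := Qcone r Qr.
  apply/CR_geP; first exact: comb0 rho0 rE.
  exists (@uniform_policy R S A); first exact: uniform_policyP.
  by rewrite mul0r; apply: (return_ge0 kP dmu); [exact: comb0 rho0 rE|exact: uniform_policyP].
have voo : (v < +oo)%E.
  have [r Qr rE] := coneQ (fun=> 1) (fun=> introT andP (conj ler01 (lexx 1))).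
  have r0 : forall h s a, (h < H)%N -> 0 <= r h s a by exact: comb0 _ rE.
  apply: (@le_lt_trans _ _ (CR H H P mu r)); first by apply: ereal_inf_lbound; exists r.
  have [[pi mpi <-] _] := CR_is_max r0.
  rewrite /ediv eqe gt_eqF ?ltry //; apply: lt_le_trans bj0 _.
  rewrite /b /benchmark (sum_linear_combination (fun h s _ => occ_star H P mu h s) rE).
  rewrite (bigD1 j0) //= mul1r lerDl; apply: sumr_ge0 => j _.
  by rewrite mul1r; apply: (benchmark_ge0 kP dmu HA); exact: W0.
suff [pi mpi vF] : exists2 pi, markov_policy H pi & (v <= F pi)%E.
  by split=> //; exists pi => //; apply/eqP; rewrite eq_le vF upper.
have vlb r : Q r -> (v <= CR H H P mu r)%E by move=> Qr; apply: ereal_inf_lbound; exists r.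
case: v v0 voo vlb {upper} => // v v0 _ vlb.
have [rho rho0|pi mpi dom] := policy_dominating kP dmu HA (W := W) (c := fun j => v * b (W j)).
  (* [coneQ] only covers coefficients in [[0, 1]]; dividing by [M] brings the weights there, and the
     inequality to be shown is homogeneous in them. *)
  pose M := 1 + \sum_j rho j.
  have M0 : 0 < M by rewrite ltr_wpDr ?sumr_ge0.
  have rho01 j : 0 <= rho j / M <= 1.
    rewrite divr_ge0 ?(ltW M0) //= ler_pdivrMr // mul1r /M (bigD1 j) //=.
    have : 0 <= \sum_(i | i != j) rho i by apply: sumr_ge0.
    by have := rho0 j; lra.
  have [r Qr rE] := coneQ _ rho01.
  have r0 : forall h s a, (h < H)%N -> 0 <= r h s a.
    by apply: comb0 rE => j; case/andP: (rho01 j).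
  have /(CR_geP _ r0)[pi mpi] := vlb r Qr.
  rewrite /b /benchmark /J /return_of.
  rewrite (sum_linear_combination (fun h s _ => occ_star H P mu h s) rE).
  rewrite (sum_linear_combination (occSA P mu pi) rE) => le.
  exists pi => //; rewrite -(ler_pM2l (_ : 0 < M^-1)) ?invr_gt0 // !mulr_sumr.
  move: le; rewrite mulr_sumr; congr (_ <= _); apply: eq_bigr => j _; rewrite /b /benchmark; ring.
exists pi => //; apply/FP => // j; apply/le_ediv => //.
  by apply: (return_ge0 kP dmu) => //; exact: W0.
by apply: (benchmark_ge0 kP dmu HA); exact: W0.
Qed.

Lemma sum_indicator2 (F : S -> A -> R) s a :
  \sum_s' \sum_a' F s' a' * ((s' == s) && (a' == a))%:R = F s a.
Proof.
rewrite (bigD1 s) //= (bigD1 a) //= !eqxx mulr1 !big1 ?addr0 //.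
  by move=> s' /negPf s's; apply: big1 => a' _; rewrite s's mulr0.
by move=> a' /negPf a'a; rewrite a'a andbF mulr0.
Qed.

Lemma sum_indicator3 (F : nat -> S -> A -> R) (i : 'I_H) s a :
  \sum_(h < H) \sum_s' \sum_a' F h s' a' *
    ((h == i :> nat) && ((s' == s) && (a' == a)))%:R = F i s a.
Proof.
rewrite (bigD1 i) //= [X in _ + X]big1 ?addr0.
  by rewrite eqxx; exact: (sum_indicator2 (F i)).
move=> h hi; apply: big1 => s' _; apply: big1 => a' _.
by rewrite (negPf (_ : h != i :> nat)) ?mulr0.
Qed.

(** It provides a generator with positive benchmark, which keeps the infimum over means finite. *)
Lemma occ_star_reachable : exists s, 0 < occ_star H P mu 0%N s.
Proof.
have [s mus] : exists s, 0 < mu s.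
  apply: contrapT => /forallNP mu0; have [mu_ge0 mu1] := dmu.
  move: mu1; rewrite big1 => [/eqP|s _]; first by rewrite eq_sym oner_eq0.
  by apply/eqP; rewrite eq_le mu_ge0 andbT leNgt; apply/negP; exact: mu0.
exists s; apply: lt_le_trans mus _.
exact: (occS_le_star kP dmu s (@uniform_policyP R S A H HA) HH).
Qed.

(** The generators pay 1 at one entry [(h, s, a)]: their returns are occupancies and their
    benchmarks values of [occ_star]. *)
Lemma CR_P_is_max : is_max (markov_policy H)
  (fun pi => min_hsa H (fun h s a =>
     ediv (occSA P mu pi h s a)%:E (occ_star H P mu h s)%:E))
  (CR_P H H P mu).
Proof.
pose W (x : 'I_H * S * A) : rew R S A := fun h s a =>
  ((h == x.1.1 :> nat) && ((s == x.1.2) && (a == x.2)))%:R.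
have JW pi x : J pi (W x) = occSA P mu pi x.1.1 x.1.2 x.2.
  exact: (sum_indicator3 (occSA P mu pi)).
have bW x : b (W x) = occ_star H P mu x.1.1 x.1.2.
  exact: (sum_indicator3 (fun h s _ => occ_star H P mu h s)).
have combE rho (h : 'I_H) s a : \sum_x rho x * W x h s a = rho (h, s, a).
  rewrite (bigD1 (h, s, a)) //= /W /= !eqxx mulr1 big1 ?addr0 // => -[[h' s'] a'] /=.
  rewrite !xpair_eqE => ne; rewrite (_ : _ && _ = false) ?mulr0 //.
  apply/negbTE; apply: contra ne => /andP[/eqP/val_inj -> /andP[/eqP -> /eqP ->]].
  by rewrite !eqxx.
apply: (@worst_means_is_max _ W).
- by move=> x h s a _; rewrite ler0n.
- have [s s0] := occ_star_reachable; have /card_gt0P[a _] := HA.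
  by exists (Ordinal HH, s, a); rewrite bW.
- move=> r r01; exists (fun x : 'I_H * S * A => r x.1.1 x.1.2 x.2).
    by move=> x; case/andP: (r01 x.1.1 x.1.2 x.2 (ltn_ord _)).
  by move=> h s a hH; rewrite -[h]/(nat_of_ord (Ordinal hH)) combE.
- move=> rho rho01; exists (fun h s a => \sum_x rho x * W x h s a) => //.
  by move=> h s a hH; rewrite -[h]/(nat_of_ord (Ordinal hH)) combE.
- move=> pi c mpi; rewrite /min_hsa; split=> [le x|le].
    rewrite JW bW; apply: (le_trans le).
    apply: (le_trans (bigmin_le_cond _ _ (j := x.1.1) _)) => //.
    apply: (le_trans (bigmin_le_cond _ _ (j := x.1.2) _)) => //.
    exact: (bigmin_le_cond _ _ (j := x.2)).
  apply/bigmin_geP; split=> [|h _]; first exact: leey.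
  apply/bigmin_geP; split=> [|s _]; first exact: leey.
  apply/bigmin_geP; split=> [|a _]; first exact: leey.
  by have := le (h, s, a); rewrite JW bW.
Qed.

(** Stationary generators pay at one pair [(s, a)] in all steps, whence the sums over [h]. *)
Lemma CR_P_stat_is_max : is_max (markov_policy H)
  (fun pi => min_sa (fun s a =>
     ediv (\sum_(h < H) occSA P mu pi h s a)%:E (\sum_(h < H) occ_star H P mu h s)%:E))
  (CR_P_stat H H P mu).
Proof.
pose W (x : S * A) : rew R S A := fun _ s a => ((s == x.1) && (a == x.2))%:R.
have JW pi x : J pi (W x) = \sum_(h < H) occSA P mu pi h x.1 x.2.
  by apply: eq_bigr => h _; exact: (sum_indicator2 (occSA P mu pi h)).
have bW x : b (W x) = \sum_(h < H) occ_star H P mu h x.1.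
  by apply: eq_bigr => h _; exact: (sum_indicator2 (fun s _ => occ_star H P mu h s)).
have combE rho h s a : \sum_x rho x * W x h s a = rho (s, a).
  rewrite (bigD1 (s, a)) //= /W /= !eqxx mulr1 big1 ?addr0 // => -[s' a'] /=.
  rewrite xpair_eqE => ne; rewrite (_ : _ && _ = false) ?mulr0 //.
  by apply/negbTE; apply: contra ne => /andP[/eqP -> /eqP ->]; rewrite !eqxx.
rewrite /CR_P_stat -(image_comp (fun r _ => r) (CR H H P mu)).
apply: (@worst_means_is_max _ W).
- by move=> x h s a _; rewrite ler0n.
- have [s s0] := occ_star_reachable; have /card_gt0P[a _] := HA.
  exists (s, a); rewrite bW (bigD1 (Ordinal HH)) //= ltr_pwDl //.
  by apply: sumr_ge0 => h _; exact: (occ_star_ge0 kP dmu HA).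
- move=> _ [r r01 <-]; exists (fun x : S * A => r x.1 x.2); first by move=> x; case/andP: (r01 x.1 x.2).
  by move=> h s a hH; rewrite combE.
- move=> rho rho01; exists (fun=> fun s a => rho (s, a)); last by move=> h s a _; rewrite combE.
  by exists (fun s a => rho (s, a)).
- move=> pi c mpi; rewrite /min_sa; split=> [le x|le].
    rewrite JW bW; apply: (le_trans le).
    apply: (le_trans (bigmin_le_cond _ _ (j := x.1) _)) => //.
    exact: (bigmin_le_cond _ _ (j := x.2)).
  apply/bigmin_geP; split=> [|s _]; first exact: leey.
  apply/bigmin_geP; split=> [|a _]; first exact: leey.
  by have := le (s, a); rewrite JW bW.
Qed.

(** The benchmark has one term per entry, and each term alone is at most the optimal return. *)
Lemma CR_ge_inv_SAH r : (forall h s a, (h < H)%N -> 0 <= r h s a) ->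
  ((1 / (#|S|%:R * #|A|%:R * H%:R))%:E <= CR H H P mu r)%E.
Proof.
move=> r0; apply/CR_geP => //; have [pi mpi pimax] := optimal_policy kP dmu HA r.
exists pi => //; set N := _ * _ * _.
suff bJ : b r <= N * J pi r.
  have [->|N0] := eqVneq N 0; first by rewrite invr0 mulr0 mul0r (return_ge0 kP dmu).
  by rewrite mul1r mulrC ler_pdivrMr 1?mulrC // lt_def N0 !mulr_ge0.
have term (h : 'I_H) s a : occ_star H P mu h s * r h s a <= J pi r.
  have [pi1 mpi1 ->] := occ_star_attained kP dmu HA s (ltn_ord h).
  (* Reaches [s] as well as possible, then surely plays [a] at step [h]. *)
  pose pi2 t s' := if t == h :> nat then fun a' => (a' == a)%:R else pi1 t s'.
  have mpi2 : markov_policy H pi2.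
    move=> t tH s'; rewrite /pi2; case: ifP => _; last exact: mpi1.
    exact: is_dist_indicator.
  apply: le_trans (pimax _ mpi2).
  have -> : occS P mu pi1 h s = occSA P mu pi2 h s a.
    rewrite /occSA {2}/pi2 !eqxx mulr1; congr (_ _); apply: eq_occS => t th.
    by apply: funext => s'; rewrite /pi2 ltn_eqF.
  have term0 (h' : 'I_H) s' a' : 0 <= occSA P mu pi2 h' s' a' * r h' s' a'.
    by rewrite mulr_ge0 ?r0 //; exact: (occSA_ge0 kP dmu).
  rewrite /return_of (bigD1 h) //= (bigD1 s) //= (bigD1 a) //= -!addrA lerDl !addr_ge0 //.
  + by apply: sumr_ge0 => a' _.
  + by apply: sumr_ge0 => s' _; apply: sumr_ge0 => a' _.
  + by apply: sumr_ge0 => h' _; apply: sumr_ge0 => s' _; apply: sumr_ge0 => a' _.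
apply: (@le_trans _ _ (\sum_(h < H) \sum_(s : S) \sum_(a : A) J pi r)).
  by do 3 (apply: ler_sum => ? _); exact: term.
rewrite !sumr_const card_ord -!mulrnA -[leLHS]mulr_natl /N !natrM.
rewrite le_eqVlt; apply/orP; left; apply/eqP.
have -> : #|(xpredT : pred A)| = #|A| by [].
ring.
Qed.

(** Each step costs one factor [#|A|]: the uniform policy gives every action at least [1 / #|A|]
    times its probability under [pi]. *)
Lemma occS_uniform_ge pi h s : markov_policy H pi -> (h <= H)%N ->
  occS P mu pi h s <= #|A|%:R ^+ h * occS P mu (@uniform_policy R S A) h s.
Proof.
move=> mpi; elim: h s => [|h IH] s hH; first by rewrite expr0 mul1r.
have A0 : #|A|%:R != 0 :> R by rewrite pnatr_eq0 -lt0n.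
rewrite /= mulr_sumr; apply: ler_sum => s' _; rewrite mulr_sumr; apply: ler_sum => a _.
rewrite exprSr /uniform_policy !mulrA; apply: ler_wpM2r; first exact: (kP hH s' a).1.
apply: (@le_trans _ _ (#|A|%:R ^+ h * occS P mu (@uniform_policy R S A) h s')); last first.
  by rewrite le_eqVlt; apply/orP; left; apply/eqP; field.
apply: le_trans (IH s' (ltnW hH)).
by rewrite ler_piMr ?(occS_ge0 kP dmu) ?is_dist_le1 //; [exact: ltnW|exact: mpi].
Qed.

Lemma CR_ge_inv_expn r : (forall h s a, (h < H)%N -> 0 <= r h s a) ->
  ((1 / (#|A|%:R ^+ H))%:E <= CR H H P mu r)%E.
Proof.
move=> r0; apply/CR_geP => //.
have A1 : 1 <= #|A|%:R :> R by rewrite ler1n.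
have A0 : 0 < #|A|%:R :> R by lra.
exists (@uniform_policy R S A); first exact: uniform_policyP.
rewrite mul1r mulrC ler_pdivrMr ?exprn_gt0 // mulrC /b /benchmark /J /return_of.
rewrite mulr_sumr; apply: ler_sum => h _; rewrite mulr_sumr; apply: ler_sum => s _.
rewrite mulr_sumr; apply: ler_sum => a _; rewrite mulrA ler_wpM2r ?r0 //.
have [pi mpi ->] := occ_star_attained kP dmu HA s (ltn_ord h).
apply: le_trans (occS_uniform_ge s mpi (ltnW (ltn_ord h))) _.
rewrite /occSA /uniform_policy mulrA mulrAC ler_wpM2r //.
  by apply: (occS_ge0 kP dmu); [exact: uniform_policyP|exact: ltnW].
(* Reaching the state cost [h] factors, the action costs one more, and [h.+1 <= H]. *)
by rewrite ler_pdivlMr // -exprSr ler_weXn2l.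
Qed.

End CompetitiveRatio.

(** * Upper bounds on returns by potentials *)

Section Potential.
Variables (R : realType) (S A : finType) (H : nat).
Variables (P : nat -> S -> A -> S -> R) (mu : S -> R).
Hypotheses (kP : is_kernel H P) (dmu : is_dist mu).

(** [phi] is a supersolution of the Bellman equation: the reward collected before step [k] plus the
    expected potential at [k] does not increase with [k]. *)
Lemma return_le_potential pi (r : rew R S A) (phi : nat -> S -> R) :
  markov_policy H pi -> (forall s, 0 <= phi H s) ->
  (forall h s a, (h < H)%N ->
     r h s a + \sum_s' P h s a s' * phi h.+1 s' <= phi h s) ->
  return_of H P mu pi r <= \sum_s mu s * phi 0%N s.
Proof.
move=> mpi phi0 step.
suff partial k : (k <= H)%N ->
    \sum_(h < k) \sum_s \sum_a occSA P mu pi h s a * r h s a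
    + \sum_s occS P mu pi k s * phi k s <= \sum_s mu s * phi 0%N s.
  apply: le_trans (partial H (leqnn H)); rewrite lerDl; apply: sumr_ge0 => s _.
  by rewrite mulr_ge0 // (occS_ge0 kP dmu).
elim: k => [|k IH] kH; first by rewrite big_ord0 add0r.
apply: le_trans (IH (ltnW kH)); rewrite big_ord_recr /= -addrA lerD2l.
have -> : \sum_s' (\sum_s \sum_a occS P mu pi k s * pi k s a * P k s a s') * phi k.+1 s'
    = \sum_s \sum_a occSA P mu pi k s a * \sum_s' P k s a s' * phi k.+1 s'.
  under eq_bigr do rewrite mulr_suml.
  rewrite exchange_big; apply: eq_bigr => s _ /=.
  under eq_bigr do rewrite mulr_suml.
  rewrite exchange_big; apply: eq_bigr => a _ /=.
  by rewrite mulr_sumr; apply: eq_bigr => s' _; rewrite /occSA mulrA.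
rewrite -big_split /=; apply: ler_sum => s _.
rewrite -big_split /= -(sum_occSA _ _ s mpi kH) mulr_suml; apply: ler_sum => a _.
by rewrite -mulrDr ler_wpM2l ?step // (occSA_ge0 kP dmu).
Qed.

End Potential.

(** Deterministic rewards suffice to exhibit an environment, as [CR] already ranges over all
    distributions with the given means. *)
Lemma sure_reward_dist (R : realType) (S A : finType) (H : nat) (r : S -> A -> R) :
  (forall s a, 0 <= r s a) ->
  reward_dist H (fun=> r) (@dirac _ unit tt R) (fun _ s a _ => r s a).
Proof.
move=> r0; split=> [//|//|h s a _|B _].
  by rewrite integral_cst //= diracT mule1.
rewrite (eq_bigr (fun h : 'I_H => `[< B h r >]%:R)); last by [].
by rewrite (prodr_asbool R H (fun h => B h r)).
Qed.

(** * Counting by numerical codes *)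

Lemma sum_interval_indicator n a b :
  (\sum_(i < n) (a <= i < b) = minn n b - a)%N.
Proof. elim: n => [|n IH]; rewrite ?big_ord0 ?big_ord_recr /= ?IH; lia. Qed.

Lemma sum_digits k m (G : nat -> nat) :
  (\sum_(i < m) \sum_(j < k) G (i * k + j) = \sum_(y < m * k) G y)%N.
Proof.
elim: m => [|m IH]; first by rewrite mul0n !big_ord0.
by rewrite big_ord_recr /= IH mulSnr big_split_ord.
Qed.

Lemma sum_enum_rank (T : finType) (G : nat -> nat) :
  (\sum_(t : T) G (enum_rank t) = \sum_(i < #|T|) G i)%N.
Proof. by rewrite [RHS](reindex (@enum_rank T)) //; exact: onW_bij (@enum_rank_bij T). Qed.

(** * Trees of digit sequences *)

Section DigitTree.
Variables (R : realType) (S A : finType) (H : nat) (root : nat) (sink : S).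
Hypotheses (HH : (0 < H)%N) (A1 : (1 < #|A|)%N).

(* States carry the codes [root, root + #|S|) and actions are digits in base
   [#|A|]: playing an action appends its digit to the code of the state, and
   codes out of range denote [sink]. *)
Definition code (s : S) : nat := (enum_rank s + root)%N.
Definition decode (y : nat) : S := nth sink (enum S) (y - root).
Definition append (s : S) (a : A) : nat := (code s * #|A| + enum_rank a)%N.

Definition tree_kernel : nat -> S -> A -> S -> R :=
  fun _ s a s' => (s' == decode (append s a))%:R.
Definition tree_start : S -> R := fun s => (s == decode root)%:R.

Lemma tree_kernelP : is_kernel H tree_kernel.
Proof. by move=> h _ s a; exact: is_dist_indicator. Qed.

Lemma tree_startP : is_dist tree_start.
Proof. exact: is_dist_indicator. Qed.

Lemma codeK : cancel code decode.
Proof. by move=> s; rewrite /decode /code addnK nth_enum_rank. Qed.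

Lemma decodeK y : (root <= y < #|S| + root)%N -> code (decode y) = y.
Proof.
move=> /andP[y1 y2]; have lt : (y - root < #|S|)%N by rewrite -(ltn_add2r root) subnK.
rewrite /code /decode (_ : nth _ _ _ = enum_val (Ordinal lt)).
  by rewrite enum_valK /= subnK.
by rewrite (enum_val_nth sink).
Qed.

(** The policy plays the last [h] digits of [x] from the most significant one, so that after [t]
    steps the code is the prefix [x %/ #|A| ^ (h - t)]. All prefixes lie between [root] and [x],
    hence are codes of states. *)
Lemma tree_reachable h x : (h < H)%N -> (x %/ #|A| ^ h)%N = root -> (x < #|S| + root)%N ->
  1 <= occ_star H tree_kernel tree_start h (decode x).
Proof.
move=> hH xroot xS; have A0 : (0 < #|A|)%N by exact: ltnW.
pose dig t : A := enum_val (Ordinal (ltn_pmod (x %/ #|A| ^ (h - t.+1))%N A0)).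
pose pi (t : nat) (s : S) (a : A) : R := (a == dig t)%:R.
have mpi : markov_policy H pi by move=> t _ s; exact: is_dist_indicator.
suff occE t s : (t <= h)%N -> occS tree_kernel tree_start pi t s
    = (s == decode (x %/ #|A| ^ (h - t))%N)%:R.
  apply: le_trans (occS_le_star tree_kernelP tree_startP _ mpi hH).
  by rewrite occE // subnn expn0 divn1 eqxx.
elim: t s => [|t IH] s th; first by rewrite /= subn0 xroot.
rewrite /=.
transitivity (\sum_s' \sum_a (s == decode (append s' a))%:R *
    ((s' == decode (x %/ #|A| ^ (h - t))%N) && (a == dig t))%:R : R).
  apply: eq_bigr => s' _; apply: eq_bigr => a _.
  by rewrite IH 1?ltnW // /pi -natrM mulnb mulrC.
rewrite (sum_indicator2 (fun s' a => (s == decode (append s' a))%:R)).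
congr (_ == decode _)%:R.
have e : (x %/ #|A| ^ (h - t) = x %/ #|A| ^ (h - t.+1) %/ #|A|)%N.
  by rewrite -divnMA -expnSr (_ : (h - t.+1).+1 = h - t)%N //; lia.
rewrite /append decodeK; last first.
  rewrite -{1}xroot leq_div2l ?expn_gt0 ?A0 // ?leq_pexp2l ?leq_subr //=.
  by apply: leq_ltn_trans xS; exact: leq_div.
by rewrite /dig enum_valK /= e -divn_eq.
Qed.

Lemma return_tree_le1 pi (r : S -> A -> R) (phi : nat -> S -> R) :
  markov_policy H pi -> (forall s, 0 <= phi H s) -> phi 0%N (decode root) <= 1 ->
  (forall h s a, (h < H)%N -> r s a + phi h.+1 (decode (append s a)) <= phi h s) ->
  return_of H tree_kernel tree_start pi (fun=> r) <= 1.
Proof.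
move=> mpi phi0 phi1 step.
have collapse s0 (F : S -> R) : \sum_s (s == s0)%:R * F s = F s0.
  rewrite (bigD1 s0) //= eqxx mul1r big1 ?addr0 // => s /negPf ->.
  by rewrite mul0r.
apply: le_trans (return_le_potential tree_kernelP tree_startP mpi phi0 _) _.
  by move=> h s a hH; rewrite /tree_kernel collapse step.
by rewrite /tree_start collapse.
Qed.

Lemma CR_tree_le (r : S -> A -> R) (phi : nat -> S -> R) (K : R) :
  (forall s a, 0 <= r s a) -> (forall s, 0 <= phi H s) ->
  phi 0%N (decode root) <= 1 ->
  (forall h s a, (h < H)%N -> r s a + phi h.+1 (decode (append s a)) <= phi h s) ->
  0 < K -> K <= benchmark H tree_kernel tree_start (fun=> r) ->
  (CR H H tree_kernel tree_start (fun=> r) <= (1 / K)%:E)%E.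
Proof.
move=> r0 phi0 phi1 step K0 Kb; have A0 : (0 < #|A|)%N by exact: ltnW.
have [[pi mpi <-] _] := CR_is_max tree_kernelP tree_startP HH A0 (r := fun=> r)
  (fun _ s a _ => r0 s a).
rewrite /ediv eqe gt_eqF ?(lt_le_trans K0) //= lee_fin.
have J1 := return_tree_le1 mpi phi0 phi1 step.
have b0 := lt_le_trans K0 Kb.
by rewrite ler_pM ?lef_pV2 ?posrE ?invr_ge0 ?(ltW b0) // (return_ge0 tree_kernelP tree_startP).
Qed.

End DigitTree.

(** * Instances matching the lower bounds *)

Section TightInstances.
Variables (R : realType) (S A : finType) (H : nat).
Hypotheses (HH : (0 < H)%N) (A1 : (1 < #|A|)%N).

Let A0 : (0 < #|A|)%N := ltnW A1.

(* The root [0] can be re-entered by the digit [0], so that each of the codes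
   below [#|A|^n] is reachable with certainty at each step [h >= n]. Leaving this
   range pays [1] and ends in the sink, so that a policy collects at most [1]. *)
Lemma tight_waiting_tree n : (n < H)%N -> #|S| = (#|A| ^ n + 1)%N ->
  exists (P : nat -> S -> A -> S -> R) (mu : S -> R) (r : S -> A -> R),
  [/\ is_kernel H P, is_dist mu, forall h h', P h = P h',
      forall s a, 0 <= r s a <= 1 &
      (CR H H P mu (fun=> r) <=
        (1 / ((H%:R - n%:R) * (#|A|%:R - 1) * #|A|%:R ^+ n))%:E)%E].
Proof.
move=> nH cS; set m := (#|A| ^ n)%N in cS *.
have ltm : (m < #|S|)%N by rewrite cS addn1.
pose sink : S := enum_val (Ordinal ltm).
have sinkE y : (m <= y)%N -> decode 0 sink y = sink.
  rewrite /decode subn0 => my; have [ym|my'] := leqP y m.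
    have -> : y = m by apply/eqP; rewrite eqn_leq ym.
    by rewrite {2}/sink (enum_val_nth sink).
  by rewrite nth_default // -cardE cS addn1.
have code_sink : code 0 sink = m by rewrite /code addn0 enum_valK.
pose win (s : S) (a : A) := ((code 0 s < m) && (m <= append 0 s a))%N.
pose r (s : S) (a : A) : R := (win s a)%:R.
have r01 s a : 0 <= r s a <= 1 by rewrite ler0n lern1 leq_b1.
have r0 s a : 0 <= r s a by case/andP: (r01 s a).
exists (@tree_kernel R S A 0 sink), (@tree_start R S 0 sink), r; split=> //.
- exact: tree_kernelP.
- exact: tree_startP.
have m0 : (0 < m)%N by rewrite expn_gt0 A0.
(* The potential is the single reward still to be earned: 1 inside the tree, 0 in the sink. *)
apply: (@CR_tree_le R S A H 0 sink HH A1 r (fun _ s => (code 0 s < m)%N%:R)) => //.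
- by rewrite lern1 leq_b1.
- move=> _ s a _; rewrite /r /win; have [sm|sm] := ltnP (code 0 s) m; last first.
    rewrite sinkE ?code_sink ?ltnn ?addr0 // /append; apply: leq_trans sm _.
    by apply: leq_trans (leq_addr _ _); rewrite leq_pmulr.
  have [am|am] := leqP m (append 0 s a); last by rewrite add0r lern1 leq_b1.
  by rewrite sinkE // code_sink ltnn addr0.
- by rewrite !mulr_gt0 ?exprn_gt0 ?subr_gt0 ?ltr_nat ?ltr1n ?ltr0n.
(* Appending digits to the codes below [m] runs once through [[0, m * #|A|)], and the results from
   [m] on pay. *)
have winC : (\sum_(s : S) \sum_(a : A) win s a = (#|A| - 1) * m)%N.
  rewrite /win /append /code.
  under eq_bigr => s _ do rewrite (sum_enum_rank A (fun j => ((enum_rank s + 0 < m) && (m <= (enum_rank s + 0) * #|A| + j)))%N).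
  rewrite (sum_enum_rank S (fun i => \sum_(j < #|A|) ((i + 0 < m) && (m <= (i + 0) * #|A| + j)))%N).
  rewrite cS addn1 big_ord_recr /= [X in (_ + X)%N]big1 ?addn0; last first.
    by move=> j _; rewrite ltnn.
  rewrite -[RHS](_ : \sum_(y < m * #|A|) (m <= y < m * #|A|) = _)%N; last first.
    by rewrite sum_interval_indicator minnn mulnBl mul1n mulnC.
  rewrite -(sum_digits _ _ (fun y => (m <= y < m * #|A|)%N : nat)).
  apply: eq_bigr => i _; apply: eq_bigr => j _; rewrite addn0 ltn_ord /=.
  rewrite (_ : (_ < _ * _)%N = true) ?andbT //.
  apply: (@leq_trans (i.+1 * #|A|)); first by rewrite mulSnr ltn_add2l.
  by rewrite leq_mul2r ltn_ord orbT.
apply: (@le_trans _ _ (\sum_(h < H) (n <= h < H)%N%:R * (\sum_(s : S) \sum_(a : A) win s a)%N%:R)).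
  rewrite -mulr_suml -natr_sum sum_interval_indicator minnn winC natrB 1?ltnW //.
  by rewrite natrM natrB // natrX mulrA.
rewrite /benchmark; apply: ler_sum => h _.
rewrite natr_sum mulr_sumr; apply: ler_sum => s _.
rewrite natr_sum mulr_sumr; apply: ler_sum => a _.
have occ0 : 0 <= occ_star H (@tree_kernel R S A 0 sink) (@tree_start R S 0 sink) h s.
  exact: (occ_star_ge0 (@tree_kernelP R S A H 0 sink) (@tree_startP R S 0 sink) A0).
rewrite /r; have [/andP[sm _]|_] := boolP (win s a); last by rewrite !mulr0.
rewrite !mulr1 ltn_ord andbT; case: (leqP n h) => // nh.
rewrite -(codeK 0 sink s); apply: tree_reachable => //.
  by rewrite divn_small //; apply: leq_trans sm _; rewrite leq_pexp2l.
by rewrite addn0 (ltn_trans sm).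
Qed.

(* Started at the code [1], the codes at step [h] lie in [[#|A|^h, 2 #|A|^h)], and
   all actions in the last level pay [1]. *)
Lemma tight_tree : (#|A| ^ H - 1 <= #|S|)%N ->
  exists (P : nat -> S -> A -> S -> R) (mu : S -> R) (r : S -> A -> R),
  [/\ is_kernel H P, is_dist mu, forall h h', P h = P h',
      forall s a, 0 <= r s a <= 1 &
      (CR H H P mu (fun=> r) <= (1 / (#|A|%:R ^+ H))%:E)%E].
Proof.
move=> cS; pose L := (#|A| ^ H.-1)%N.
have AH : (#|A| ^ H = L * #|A|)%N by rewrite -expnSr prednK.
have L0 : (0 < L)%N by rewrite expn_gt0 A0.
(* The tree fits into [S]: with at least two actions, its codes [1, ..., 2 * L - 1] are all in
   range. *)
have L2 : (2 * L <= #|S| + 1)%N by rewrite AH in cS; nia.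
have /card_gt0P[sink _] : (0 < #|S|)%N by lia.
pose leaf (s : S) := (L <= code 1 s < 2 * L)%N.
pose r (s : S) (_ : A) : R := (leaf s)%:R.
have r01 s a : 0 <= r s a <= 1 by rewrite ler0n lern1 leq_b1.
have r0 s a : 0 <= r s a by case/andP: (r01 s a).
exists (@tree_kernel R S A 1 sink), (@tree_start R S 1 sink), r; split=> //.
- exact: tree_kernelP.
- exact: tree_startP.
pose level h (s : S) := (#|A| ^ h <= code 1 s < 2 * #|A| ^ h)%N.
(* A state on the level of the current step can still earn 1. The inequality is also required at
   states off their level, which receive the crude bound of 1 per remaining step. *)
pose phi h (s : S) : R := if (h < H)%N then if level h s then 1 else (H - h)%:R else 0.
apply: (@CR_tree_le R S A H 1 sink HH A1 r phi) => //.
- by move=> s; rewrite /phi ltnn.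
- by rewrite /phi HH /level decodeK //; lia.
- move=> h s a hH; rewrite /phi hH; have [hH'|Hh] := ltnP h.+1 H; last first.
    have -> : h = H.-1 by lia.
    rewrite addr0 /level -/L -/(leaf s); case: ifP => _; rewrite /r ?lern1 ?leq_b1 //.
    by rewrite (_ : H - H.-1 = 1)%N ?lern1 ?leq_b1 //; lia.
  have [ls|ls] := boolP (level h s).
    have ls' : level h.+1 (decode 1 sink (append 1 s a)).
      have d := ltn_ord (enum_rank a); case/andP: ls => lo hi.
      have hL : (2 * #|A| ^ h.+1 <= 2 * L)%N by rewrite leq_mul2l leq_pexp2l //; lia.
      have h0 : (0 < #|A| ^ h.+1)%N by rewrite expn_gt0 A0.
      have lo' : (#|A| ^ h.+1 <= code 1 s * #|A|)%N by rewrite expnSr leq_mul2r lo orbT.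
      have hi' : ((code 1 s).+1 * #|A| <= 2 * #|A| ^ h.+1)%N.
        by rewrite expnSr mulnA leq_mul2r hi orbT.
      have lo2 : (#|A| ^ h.+1 <= append 1 s a)%N := leq_trans lo' (leq_addr _ _).
      have hi2 : (append 1 s a < 2 * #|A| ^ h.+1)%N.
        by apply: leq_trans hi'; rewrite /append mulSn addnC ltn_add2r.
      rewrite /level decodeK ?lo2 // (leq_trans h0 lo2) /=.
      by rewrite (leq_trans hi2) // (leq_trans hL).
    (* Before the last level there are no leaves, since [2 * #|A| ^ h <= #|A| ^ h.+1 <= L]. *)
    rewrite ls' /r (_ : leaf s = false) ?add0r //.
    have : (#|A| ^ h.+1 <= L)%N by rewrite leq_pexp2l //; lia.
    move: ls; rewrite /level /leaf expnS; nia.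
  have r1 : r s a <= 1 by case/andP: (r01 s a).
  have -> : (H - h = (H - h.+1).+1)%N by lia.
  rewrite -natr1 addrC lerD //; case: ifP => // _.
  by rewrite ler1n; lia.
- by rewrite exprn_gt0 // ltr0n.
rewrite /benchmark.
have HP : (H.-1 < H)%N by rewrite prednK.
have occ0 h s : (h < H)%N -> 0 <= occ_star H (@tree_kernel R S A 1 sink) (@tree_start R S 1 sink) h s.
  exact: (occ_star_ge0 (@tree_kernelP R S A H 1 sink) (@tree_startP R S 1 sink) A0).
(* The last step alone suffices: it contributes [L] leaves with [#|A|] paying actions each. *)
rewrite (bigD1 (Ordinal HP)) //= ler_wpDr //.
  apply: sumr_ge0 => h _; apply: sumr_ge0 => s _; apply: sumr_ge0 => a _.
  by rewrite mulr_ge0 // occ0.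
apply: (@le_trans _ _ (\sum_(s : S) \sum_(a : A) (leaf s)%:R)); last first.
  apply: ler_sum => s _; apply: ler_sum => a _; rewrite /r.
  have [/andP[Ls sL]|_] := boolP (leaf s); last by rewrite mulr0.
  rewrite mulr1 -(codeK 1 sink s); apply: tree_reachable => //; last by lia.
  by apply/eqP; rewrite eqn_leq -ltnS ltn_divLR // leq_divRL // -/L; lia.
under eq_bigr do rewrite sumr_const.
rewrite sumrMnl -natr_sum /leaf /code.
rewrite (sum_enum_rank S (fun i => (L <= i + 1 < 2 * L)%N)).
rewrite (eq_bigr (fun i : 'I_#|S| => (L - 1 <= i < 2 * L - 1)%N : nat)); last first.
  by move=> i _; congr nat_of_bool; lia.
rewrite sum_interval_indicator -natrX -mulrnA ler_nat AH (minn_idPr _); last by lia.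
by rewrite (_ : 2 * L - 1 - (L - 1) = L)%N //; lia.
Qed.

End TightInstances.

Theorem theorem1 (R : realType) (S A : finType) (H : nat)
  (HH : (0 < H)%N) (HA : (0 < #|{: A}|)%N) :
  (* 1. worst-case distributions *)
  (forall (P : nat -> S -> A -> S -> R) (mu : S -> R) (r : rew R S A),
     is_kernel H P -> is_dist mu ->
     (forall h s a, (h < H)%N -> 0 <= r h s a) ->
     is_max (markov_policy H)
       (fun pi => ediv
          (\sum_(h < H) \sum_(s : S) \sum_(a : A) occSA P mu pi h s a * r h s a)%:E
          (\sum_(h < H) \sum_(s : S) \sum_(a : A) occ_star H P mu h s * r h s a)%:E)
       (CR H H P mu r)) /\
  (* 2. worst-case reward expectations *)
  (forall (P : nat -> S -> A -> S -> R) (mu : S -> R),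
     is_kernel H P -> is_dist mu ->
     is_max (markov_policy H)
       (fun pi => min_hsa H (fun h s a =>
          ediv (occSA P mu pi h s a)%:E (occ_star H P mu h s)%:E))
       (CR_P H H P mu) /\
     is_max (markov_policy H)
       (fun pi => min_sa (fun s a =>
          ediv (\sum_(h < H) occSA P mu pi h s a)%:E
               (\sum_(h < H) occ_star H P mu h s)%:E))
       (CR_P_stat H H P mu)) /\
  (* 3. worst-case environments: lower bound *)
  (forall (P : nat -> S -> A -> S -> R) (mu : S -> R) (r : rew R S A),
     is_kernel H P -> is_dist mu ->
     (forall h s a, (h < H)%N -> 0 <= r h s a) ->
     ((Num.max (1 / (#|{: S}|%:R * #|{: A}|%:R * H%:R)) (1 / (#|{: A}|%:R ^+ H)))%:E
       <= CR H H P mu r)%E) /\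
  (* 3. worst-case environments: matching constructions (A >= 2) *)
  ((1 < #|{: A}|)%N -> forall delta : R, 0 < delta < 1 ->
     (forall n : nat, (n < H)%N -> #|{: S}| = (#|{: A}| ^ n + 1)%N ->
       exists (P : nat -> S -> A -> S -> R) (mu : S -> R) (r : rew R S A)
         (d : measure_display) (Omega : measurableType d)
         (Pr : probability Omega R) (X : nat -> S -> A -> Omega -> R),
         [/\ is_kernel H P /\ is_dist mu, reward_dist H r Pr X,
             stationary H P Pr X,
             (forall h s a om, (h < H)%N -> 0 <= X h s a om <= 1) &
             (CR H H P mu r <=
               ((1 + delta) /
                ((H%:R - ln ((#|{: S}| - 1)%:R) / ln (#|{: A}|%:R))
                 * (#|{: A}|%:R - 1) * (#|{: S}|%:R - 1)))%:E)%E]) /\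
     ((#|{: A}| ^ H - 1 <= #|{: S}|)%N ->
       exists (P : nat -> S -> A -> S -> R) (mu : S -> R) (r : rew R S A)
         (d : measure_display) (Omega : measurableType d)
         (Pr : probability Omega R) (X : nat -> S -> A -> Omega -> R),
         [/\ is_kernel H P /\ is_dist mu, reward_dist H r Pr X,
             stationary H P Pr X,
             (forall h s a om, (h < H)%N -> 0 <= X h s a om <= 1) &
             (CR H H P mu r <= ((1 + delta) / (#|{: A}|%:R ^+ H))%:E)%E])).
Proof.
have lt0S (x : R) : 0 < x -> forall delta : R, 0 < delta < 1 ->
    ((1 / x)%:E <= ((1 + delta) / x)%:E)%E.
  by move=> x0 delta /andP[d0 _]; rewrite lee_fin ler_wpM2r ?invr_ge0 ?(ltW x0) // lerDl ltW.
split; [|split; [|split]].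
- by move=> P mu r kP dmu r0; exact: CR_is_max.
- by move=> P mu kP dmu; split; [exact: CR_P_is_max|exact: CR_P_stat_is_max].
- move=> P mu r kP dmu r0; case: (leP (1 / (#|{: S}|%:R * #|{: A}|%:R * H%:R))) => _.
    exact: CR_ge_inv_expn.
  exact: CR_ge_inv_SAH.
move=> A1 delta d01.
have A0 : 1 < #|{: A}|%:R :> R by rewrite ltr1n.
have env (P : nat -> S -> A -> S -> R) (mu : S -> R) (r : S -> A -> R) (x : R) :
    is_kernel H P -> is_dist mu -> (forall h h', P h = P h') ->
    (forall s a, 0 <= r s a <= 1) -> 0 < x ->
    (CR H H P mu (fun=> r) <= (1 / x)%:E)%E ->
    exists (P : nat -> S -> A -> S -> R) (mu : S -> R) (r : rew R S A)
         (d : measure_display) (Omega : measurableType d)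
         (Pr : probability Omega R) (X : nat -> S -> A -> Omega -> R),
         [/\ is_kernel H P /\ is_dist mu, reward_dist H r Pr X,
             stationary H P Pr X,
             (forall h s a om, (h < H)%N -> 0 <= X h s a om <= 1) &
             (CR H H P mu r <= ((1 + delta) / x)%:E)%E].
  move=> kP dmu stP r01 x0 le.
  exists P, mu, (fun=> r), default_measure_display, unit, (@dirac _ unit tt R), (fun _ s a _ => r s a).
  split=> //.
  - by apply: sure_reward_dist => s a; case/andP: (r01 s a).
  - by apply: le_trans le _; exact: lt0S.
split=> [n nH cS|cS].
  have [P [mu [r [kP dmu stP r01 le]]]] := tight_waiting_tree R HH A1 nH cS.
  have Sn : #|{: S}|%:R - 1 = #|{: A}|%:R ^+ n :> R by rewrite cS natrD addrK natrX.
  have Sn' : (#|{: S}| - 1)%:R = #|{: A}|%:R ^+ n :> R by rewrite cS addnK natrX.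
  (* The quotient of logarithms equals [n], because [#|S| - 1] is the [n]-th power of [#|A|]. *)
  rewrite Sn Sn' lnXn ?(lt_trans ltr01) // -[ln _ *+ n]mulr_natl mulfK ?gt_eqF ?ln_gt0 //.
  apply: env le => //; rewrite !mulr_gt0 ?subr_gt0 ?ltr_nat ?exprn_gt0 ?(lt_trans ltr01) //.
have [P [mu [r [kP dmu stP r01 le]]]] := tight_tree R HH A1 cS.
by apply: env le => //; rewrite exprn_gt0 // (lt_trans ltr01).
Qed.
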